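(* Assume that every minimizer of $E$ over $H^1$ is locally unique up to gauge transformation, and that the family $(V_h)_h$ satisfies properties (P1) and (P2) stated in the context. Let $u$ be a minimizer of $E$ over $H^1$. Then, with constants $c,C>0$ independent of $h$ and $\kappa$, the following holds. (a) If $\kappa\,C_{\mathrm{sol}}(u,\kappa)\,h$ is sufficiently small (i.e. $\kappa\,C_{\mathrm{sol}}(u,\kappa)\,h\le c$), then for all $w_h\in V_h^\perp$ $$\|w_h\|_{H^1_\kappa}\le C\,C_{\mathrm{sol}}(u,\kappa)\sup_{0\neq\varphi_h\in V_h^\perp}\frac{\langle E''(u)w_h,\varphi_h\rangle}{\|\varphi_h\|_{H^1_\kappa}}.$$ (b) For any $f\in(H^1_{\mathrm iu})'$ there is a unique $w_h\in V_h^\perp$ such that $$\langle E''(u)w_h,\varphi_h\rangle=\langle f,\varphi_h\rangle\quad\text{for all }\varphi_h\in V_h^\perp,$$ and it holds $$\|w_h\|_{H^1_\kappa}\le C\,C_{\mathrm{sol}}(u,\kappa)\,\|f\|_{(H^1_\kappa)'}.$$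
   Context: Let $d\in\{2,3\}$, $\Omega\subset\mathbb R^d$ a bounded polygonal/polyhedral Lipschitz domain with outer unit normal $\nu$, $\kappa>0$, and $A\in L^\infty(\Omega,\mathbb R^d)$ with $\operatorname{div}A=0$ in $\Omega$ and $A\cdot\nu=0$ on $\partial\Omega$; $A_\infty=\|A\|_{L^\infty}$. $z^*$ denotes complex conjugation. $L^2=L^2(\Omega,\mathbb C)$ and $H^1=H^1(\Omega,\mathbb C)$ are regarded as real Hilbert spaces, with $m(v,w)=\mathrm{Re}\int_\Omega v w^*\,dx$ as inner product on $L^2$; dual spaces consist of real-linear functionals and Fréchet derivatives are real. Energy: $E(v)=\frac12\int_\Omega\bigl(|\nabla v+\mathrm i\kappa Av|^2+\frac{\kappa^2}{2}(1-|v|^2)^2\bigr)\,dx$ for $v\in H^1$. A minimizer of $E$ is a global minimizer over $H^1$. Its second derivative is $\langle E''(u)v,\varphi\rangle=\mathrm{Re}\int_\Omega(\nabla v+\mathrm i\kappa Av)\cdot(\nabla\varphi+\mathrm i\kappa A\varphi)^*+\kappa^2\bigl((|u|^2-1)v\varphi^*+u^2v^*\varphi^*+|u|^2v\varphi^*\bigr)\,dx$. Stabilized form: $\hat a_\kappa(v,\varphi)=\mathrm{Re}\int_\Omega(\nabla v+\mathrm i\kappa Av)\cdot(\nabla\varphi+\mathrm i\kappa A\varphi)^*\,dx+\beta^2m(v,\varphi)$ with $\beta^2=\kappa^2(A_\infty^2+1)$. Norm: $\|\varphi\|_{H^1_\kappa}^2=\|\nabla\varphi\|_{L^2}^2+\kappa^2\|\varphi\|_{L^2}^2$;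 $\|f\|_{(H^1_\kappa)'}$ is the dual norm of $f$ with respect to $\|\cdot\|_{H^1_\kappa}$ (the supremum being over nonzero elements of the space on which $f$ is defined, here $H^1_{\mathrm iu}$). A minimizer $u$ is locally unique up to gauge transformation if for all smooth curves $\gamma:[-\pi,\pi)\to H^1$ with $\gamma(0)=u$: $\frac{d^2}{dt^2}E(\gamma(t))|_{t=0}=0$ if and only if $\gamma'(0)\in\{\alpha\,\mathrm iu:\alpha\in\mathbb R\}$. For a minimizer $u$ put $H^1_{\mathrm iu}=\{\varphi\in H^1: m(\mathrm iu,\varphi)=0\}$. Under local uniqueness there is a constant $C_{\mathrm{sol}}(u,\kappa)$, bounded below by a positive constant independent of $\kappa$ and $h$, such that $C_{\mathrm{sol}}(u,\kappa)^{-1}\le\inf_{0\ne v\in H^1_{\mathrm iu}}\sup_{0\ne\varphi\in H^1_{\mathrm iu}}\frac{\langle E''(u)v,\varphi\rangle}{\|v\|_{H^1_\kappa}\|\varphi\|_{H^1_\kappa}}$; such a constant is fixed. $V_h\subset H^1$ are finite-dimensional (nonempty) subspaces indexed by a parameter $h>0$; $V_h^\perp=V_h\cap H^1_{\mathrm iu}$, and $\mathrm R^\perp_{\kappa,h}:H^1_{\mathrm iu}\to V_h^\perp$ is the $\hat a_\kappa$-orthogonal projection: $\hat a_\kappa(\mathrm R^\perp_{\kappa,h}w,\varphi_h)=\hat a_\kappa(w,\varphi_h)$ for all $\varphi_h\in V_h^\perp$. Properties: (P1) for each $\varphi\in H^1$, $\lim_{h\to0}\inf_{\varphi_h\in V_h}\|\varphi-\varphi_h\|_{H^1}=0$.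 (P2) For every minimizer $u$: if $w\in H^1_{\mathrm iu}$ and $f\in L^2$ satisfy $\hat a_\kappa(w,\varphi)=m(f,\varphi)$ for all $\varphi\in H^1_{\mathrm iu}$, then $\|w-\mathrm R^\perp_{\kappa,h}w\|_{H^1_\kappa}\le C_{\mathrm{app}}\,h\,\|f\|_{L^2}$ with $C_{\mathrm{app}}$ independent of $h$ and $\kappa$. Constants may depend on $\Omega$, $A$, $C_{\mathrm{app}}$. *)

(* Defs.v *)
From HB Require Import structures.
From mathcomp Require Import all_boot all_order all_algebra.
From mathcomp Require Import complex.
From mathcomp Require Import all_classical all_reals all_analysis.
From mathcomp Require Import ess_sup_inf.

Set Implicit Arguments.
Unset Strict Implicit.
Unset Printing Implicit Defensive.

Import Order.TTheory GRing.Theory Num.Theory.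
Import numFieldNormedType.Exports.

Local Open Scope classical_set_scope.
Local Open Scope ring_scope.

Definition measure_rV_display : measure_display -> measure_display.
Proof. exact. Qed.

Section measurable_rV.
Context {d} {T : measurableType d} (n : nat).

Let coors : 'I_n -> 'rV[T]_n -> T := fun i x => x ord0 i.

Let rV_set0 : g_sigma_preimage coors set0.
Proof. exact: sigma_algebra0. Qed.

Let rV_setC A : g_sigma_preimage coors A -> g_sigma_preimage coors (~` A).
Proof. exact: sigma_algebraC. Qed.

Let rV_bigcup (F : _^nat) : (forall i, g_sigma_preimage coors (F i)) ->
  g_sigma_preimage coors (\bigcup_i (F i)).
Proof. exact: sigma_algebra_bigcup. Qed.

HB.instance Definition _ := @isMeasurable.Build (measure_rV_display d)
  'rV[T]_n (g_sigma_preimage coors) rV_set0 rV_setC rV_bigcup.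
End measurable_rV.


Section lebesgue_rV.
Context {R : realType}.

Definition rVcons n (p : measurableTypeR R * 'rV[R]_n) : 'rV[R]_n.+1 :=
  row_mx (p.1)%:M p.2 : 'rV[R]_(1 + n).

Definition rVbehead n (x : 'rV[R]_n.+1) : 'rV[R]_n :=
  rsubmx (x : 'rV[R]_(1 + n)).

Lemma measurable_coord n (i : 'I_n) :
  measurable_fun setT (fun x : 'rV[R]_n => x ord0 i).
Proof.
move=> _ Y mY; rewrite setTI; apply: sub_sigma_algebra => /=.
rewrite -bigcup_seq/=; exists i => /=; first by rewrite mem_index_enum.
by exists Y => //; rewrite setTI.
Qed.

Lemma measurable_fun_rV d (T : measurableType d) n (f : T -> 'rV[R]_n) :
  (forall i, measurable_fun setT (fun x => f x ord0 i)) ->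
  measurable_fun setT f.
Proof.
move=> mf; pose G : set (set 'rV[R]_n) := \big[setU/set0]_(i < n)
  preimage_set_system setT (fun x : 'rV[R]_n => x ord0 i) measurable.
apply: (@measurability _ _ _ _ _ _ G) => //.
move=> _ [A + <-]; rewrite /G -bigcup_seq => -[i _ [B mB <-]].
by have := mf i measurableT B mB; rewrite !setTI.
Qed.

Lemma measurable_rVcons n : measurable_fun setT (@rVcons n).
Proof.
apply: measurable_fun_rV => i.
case: (@split_ordP 1 n i) => j ->.
  rewrite (_ : (fun _ => _) = fst) //.
  apply/funext => p.
  apply: etrans (row_mxEl ((p.1)%:M : 'rV[R]_1) p.2 ord0 j) _.
  by rewrite (ord1 j) mxE eqxx.
rewrite (_ : (fun _ => _) =
    (fun x : 'rV[R]_n => x ord0 j) \o @snd (measurableTypeR R) _).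
  apply: measurableT_comp => //; exact: measurable_coord.
apply/funext => p.
exact: (row_mxEr ((p.1)%:M : 'rV[R]_1) p.2 ord0 j).
Qed.

Lemma measurable_rVbehead n : measurable_fun setT (@rVbehead n).
Proof.
apply: measurable_fun_rV => i.
rewrite (_ : (fun _ => _) =
    (fun x : 'rV[R]_(n.+1) => x ord0 (rshift 1 i))).
  exact: measurable_coord.
by apply/funext => x; rewrite !mxE.
Qed.

Section cons_measure.
Variables (n : nat) (m : {sigma_finite_measure set 'rV[R]_n -> \bar R}).

Definition cons_measure : set 'rV[R]_n.+1 -> \bar R :=
  pushforward (@lebesgue_measure R \x m)%E (@rVcons n).

Let cons_measure0 : cons_measure set0 = 0%E.
Proof. by rewrite /cons_measure /pushforward preimage_set0 measure0. Qed.

Let cons_measure_ge0 A : (0 <= cons_measure A)%E.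
Proof.
exact: (measure_ge0 (@lebesgue_measure R \x m)%E).
Qed.

Let cons_measure_sigma_additive : semi_sigma_additive cons_measure.
Proof.
move=> F mF tF mUF; rewrite /cons_measure /pushforward preimage_bigcup.
apply: measure_semi_sigma_additive.
- by move=> k; rewrite -[X in measurable X]setTI; exact: measurable_rVcons.
- apply/trivIsetP => /= i j _ _ ij; rewrite -preimage_setI.
  by move/trivIsetP : tF => /(_ _ _ _ _ ij) ->//; rewrite preimage_set0.
- rewrite -preimage_bigcup -[X in measurable X]setTI.
  exact: measurable_rVcons.
Qed.

HB.instance Definition _ := isMeasure.Build _ _ _ cons_measure
  cons_measure0 cons_measure_ge0 cons_measure_sigma_additive.

Let cons_measure_sigma_finite : sigma_finite setT cons_measure.
Proof.
have /sigma_finiteP[F [TF ndF Foo]] := sigma_finiteT (@lebesgue_measure R).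
have /sigma_finiteP[G [TG ndG Goo]] := sigma_finiteT m.
pose dec (x : 'rV[R]_n.+1) : measurableTypeR R * 'rV[R]_n :=
  (x ord0 ord0, rVbehead x).
have mdec : measurable_fun setT dec.
  apply/measurable_fun_pairP; split; first exact: measurable_coord.
  exact: measurable_rVbehead.
have decK : cancel (@rVcons n) dec.
  move=> [a x]; rewrite /dec /rVcons /rVbehead row_mxKr; congr (_, _).
  have -> : ord0 = lshift n (ord0 : 'I_1) :> 'I_(1 + n) by exact/val_inj.
  apply: etrans (row_mxEl (a%:M : 'rV[R]_1) x ord0 ord0) _.
  by rewrite mxE eqxx.
exists (fun k => dec @^-1` (F k `*` G k)) => [|k].
  rewrite -preimage_bigcup; apply/seteqP; split => // y _ /=.
  case: (dec y) => a x.
  have [k _ Fa] : (\bigcup_k F k) a by rewrite -TF.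
  have [l _ Gx] : (\bigcup_k G k) x by rewrite -TG.
  exists (maxn k l) => //; split => /=.
  - by move: a Fa; exact/subsetPset/ndF/leq_maxl.
  - by move: x Gx; exact/subsetPset/ndG/leq_maxr.
have [[mF Fk] [mG Gk]] := (Foo k, Goo k); split.
  by rewrite -[X in measurable X]setTI; apply: mdec => //; exact: measurableX.
rewrite /cons_measure /pushforward -comp_preimage (_ : dec \o _ = id)//.
  by rewrite preimage_id product_measure1E// lte_mul_pinfty// ge0_fin_numE.
exact/funext.
Qed.

HB.instance Definition _ := Measure_isSigmaFinite.Build _ _ _ cons_measure
  cons_measure_sigma_finite.
End cons_measure.

Let dirac0_sigma_finite : sigma_finite setT (\d_(0 : 'rV[R]_0) : set _ -> \bar R).
Proof.
by apply: fin_num_fun_sigma_finite => //; rewrite measure0.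
Qed.

(** Lebesgue measure on ['rV[R]_n], by iterating the product with Lebesgue
    measure on the first coordinate. *)
Fixpoint lebesgue_rV n : {sigma_finite_measure set 'rV[R]_n -> \bar R} :=
  if n is k.+1 then cons_measure (lebesgue_rV k)
  else \d_(0 : 'rV[R]_0).
End lebesgue_rV.


Section domain.
Context {R : realType} {d : nat}.
Implicit Types (x y e : 'rV[R]_d) (Omega : set 'rV[R]_d).

Definition dotr x y : R := \sum_(i < d) x ord0 i * y ord0 i.

Definition enorm x : R := Num.sqrt (dotr x x).

Definition boundary Omega : set 'rV[R]_d := closure Omega `\` interior Omega.

(** Near each boundary point, [Omega] is, in the direction of a unit vector
    [e], the region strictly below the graph of a Lipschitz function of the
    component orthogonal to [e]. *)
Definition lipschitz_boundary Omega : Prop :=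
  forall x, boundary Omega x ->
    exists e (L : R) (g : 'rV[R]_d -> R) (U : set 'rV[R]_d),
      [/\ dotr e e = 1,
          (forall y z, `|g y - g z| <= L * enorm (y - z)),
          nbhs x U
        & forall y, U y -> (Omega y <-> dotr y e < g (y - dotr y e *: e))].

Definition convex_hull_seq (s : seq 'rV[R]_d) : set 'rV[R]_d :=
  [set x | exists c : 'I_(size s) -> R,
    [/\ forall i, 0 <= c i, \sum_i c i = 1 & x = \sum_i c i *: s`_i]].

(** The boundary is a finite union of flat faces, each the convex hull of
    finitely many points lying on a common affine hyperplane. *)
Definition polytopal_boundary Omega : Prop :=
  exists (N : nat) (F : 'I_N -> seq 'rV[R]_d),
    (forall k, exists (nu : 'rV[R]_d) (c : R),
        nu != 0 /\ forall p, p \in F k -> dotr nu p = c) /\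
    boundary Omega = \bigcup_k convex_hull_seq (F k).

Definition polytopal_lipschitz_domain Omega : Prop :=
  [/\ Omega !=set0, open Omega, connected Omega, bounded_set Omega
    & lipschitz_boundary Omega /\ polytopal_boundary Omega].

End domain.

Section sobolev.
Context {R : realType} {d : nat}.
Local Notation Rd := 'rV[R]_d.
Local Notation C := (R[i]).
Local Notation leb := (@lebesgue_rV R d).

(** An element of [H^1] is represented by a pair [(v, grad v)] made of a
    complex-valued function and a version of its weak gradient (unique a.e.);
    such pairs are compared with [H1_eq] below.  [H^1] is a real vector space:
    subspaces and functionals only use scalars [a%:C]. *)
Definition jet : Type := ((Rd -> C) * (Rd -> 'rV[C]_d))%type.

Variable Omega : set Rd.
Implicit Types (v f : Rd -> C) (g : Rd -> 'rV[C]_d) (w z : jet).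

Definition jscale (a : C) w : jet :=
  (fun x => a * w.1 x, fun x => a *: w.2 x).

Definition jadd w z : jet :=
  (fun x => w.1 x + z.1 x, fun x => w.2 x + z.2 x).

Definition jsub w z : jet := jadd w (jscale (-1) z).

Definition jzero : jet := (fun=> 0, fun=> 0).

Definition jcomb n (c : 'I_n -> R) (b : 'I_n -> jet) : jet :=
  \big[jadd/jzero]_(i < n) jscale ((c i)%:C)%C (b i).

Definition H1_eq w z : Prop :=
  {ae leb, forall x, Omega x -> w.1 x = z.1 x /\ w.2 x = z.2 x}.

Definition cintegral (f : Rd -> C) : C :=
  Complex (\int[leb]_(x in Omega) complex.Re (f x))
          (\int[leb]_(x in Omega) complex.Im (f x)).

Definition cmeasurable f : Prop :=
  measurable_fun Omega (fun x => complex.Re (f x)) /\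
  measurable_fun Omega (fun x => complex.Im (f x)).

Definition L2 f : Prop :=
  cmeasurable f /\
  (\int[leb]_(x in Omega) ((Normc.normc (f x) ^+ 2)%:E) < +oo)%E.

Definition L2norm f : R :=
  Num.sqrt (\int[leb]_(x in Omega) (Normc.normc (f x) ^+ 2)).

Definition mform v f : R :=
  complex.Re (cintegral (fun x => v x * (f x)^*%C)).

Definition partial (i : 'I_d) (phi : Rd -> R) : Rd -> R :=
  'D_(delta_mx ord0 i) phi.

(** Infinitely differentiable: all iterated partial derivatives are
    (Frechet) differentiable. *)
Definition smooth (phi : Rd -> R) : Prop :=
  forall (s : seq 'I_d) (x : Rd), differentiable (foldr partial phi s) x.

Definition test_function (phi : Rd -> R) : Prop :=
  [/\ smooth phi, compact (closure [set x | phi x != 0])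
    & closure [set x | phi x != 0] `<=` Omega].

Definition weak_gradient v g : Prop :=
  forall phi, test_function phi -> forall i : 'I_d,
    cintegral (fun x => v x * ((partial i phi x)%:C)%C) =
    - cintegral (fun x => g x ord0 i * ((phi x)%:C)%C).

Definition H1 : set jet :=
  [set w : jet | [/\ L2 w.1, forall i, L2 (fun x => w.2 x ord0 i)
             & weak_gradient w.1 w.2]].

Definition cdot (a b : 'rV[C]_d) : C :=
  \sum_(i < d) a ord0 i * (b ord0 i)^*%C.

Definition cvnorm2 (a : 'rV[C]_d) : R :=
  \sum_(i < d) Normc.normc (a ord0 i) ^+ 2.

Definition H1k_norm (kappa : R) w : R :=
  Num.sqrt (\int[leb]_(x in Omega) cvnorm2 (w.2 x) +
            kappa ^+ 2 * \int[leb]_(x in Omega) (Normc.normc (w.1 x) ^+ 2)).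

Definition H1_norm w : R := H1k_norm 1 w.

(** [D n] is the [n]-th derivative of the curve [D 0] on [[-pi, pi)]; the
    difference quotients converge in [H^1]. *)
Definition smooth_curve (D : nat -> R -> jet) : Prop :=
  forall n t, -pi <= t < pi ->
    H1 (D n t) /\
    (fun s => H1_norm (jsub
       (jscale (((s - t)^-1)%:C)%C (jsub (D n s) (D n t))) (D n.+1 t)))
      @ within (`[-pi, pi[)%classic t^' --> (0 : R).

Definition fin_dim_subspace (V : set jet) : Prop :=
  exists (n : nat) (b : 'I_n -> jet),
    (forall i, H1 (b i)) /\
    V = [set w : jet | H1 w /\ exists c : 'I_n -> R, H1_eq w (jcomb c b)].

(** When [S] is the zero space the set is empty and its [sup] is [0]. *)
Definition dual_norm (kappa : R) (S : set jet) (F : jet -> R) : R :=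
  sup [set F phi / H1k_norm kappa phi | phi in
       [set phi | S phi /\ ~ H1_eq phi jzero]].

Definition dual_functional (kappa : R) (S : set jet) (F : jet -> R) : Prop :=
  (forall (a b : R) (phi psi : jet), S phi -> S psi ->
      F (jadd (jscale (a%:C)%C phi) (jscale (b%:C)%C psi)) =
      a * F phi + b * F psi) /\
  exists K : R, forall phi, S phi -> `|F phi| <= K * H1k_norm kappa phi.

End sobolev.

Section ginzburg_landau.
Context {R : realType} {d : nat}.
Local Notation Rd := 'rV[R]_d.
Local Notation C := (R[i]).
Local Notation leb := (@lebesgue_rV R d).
Local Notation jet := (@jet R d).

Variables (Omega : set Rd) (A : Rd -> Rd) (kappa : R).
Implicit Types (u v w phi : jet).

Local Notation H1 := (H1 Omega).
Local Notation H1_eq := (H1_eq Omega).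
Local Notation norm := (H1k_norm Omega kappa).
Local Notation nrm2 z := (Normc.normc z ^+ 2).

Definition ess_supA : \bar R :=
  ess_sup leb ((fun x => (enorm (A x))%:E) \_ Omega).

Definition Linfty_field : Prop :=
  (forall i, measurable_fun Omega (fun x => A x ord0 i)) /\
  (ess_supA < +oo)%E.

Definition Ainf : R := fine ess_supA.

Definition divergence_free : Prop :=
  forall phi : Rd -> R, test_function Omega phi ->
    \int[leb]_(x in Omega) (\sum_(i < d) A x ord0 i * partial i phi x) = 0.

(** For a divergence-free [A], the normal trace [A . nu] is the functional
    [w |-> int_Omega A . grad w] on [H^1], by Green's formula. *)
Definition zero_normal_trace : Prop :=
  forall w, H1 w ->
    cintegral Omega (fun x => \sum_(i < d) ((A x ord0 i)%:C)%C * w.2 x ord0 i)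
    = 0.

Definition mgrad v (x : Rd) : 'rV[C]_d :=
  v.2 x + ('i%C * (kappa%:C)%C * v.1 x) *:
          (\row_i ((A x ord0 i)%:C)%C).

Definition energy v : \bar R :=
  ((2^-1)%:E * \int[leb]_(x in Omega)
    (cvnorm2 (mgrad v x) +
     kappa ^+ 2 / 2 * (1 - nrm2 (v.1 x)) ^+ 2)%:E)%E.

Definition minimizer u : Prop :=
  H1 u /\ forall v, H1 v -> (energy u <= energy v)%E.

(** [<E''(u) v, phi>] *)
Definition energy2 u v phi : R :=
  complex.Re (cintegral Omega (fun x =>
    cdot (mgrad v x) (mgrad phi x) +
    ((kappa ^+ 2)%:C)%C *
      (((nrm2 (u.1 x) - 1)%:C)%C * v.1 x * (phi.1 x)^*%C +
       (u.1 x) ^+ 2 * (v.1 x)^*%C * (phi.1 x)^*%C +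
       ((nrm2 (u.1 x))%:C)%C * v.1 x * (phi.1 x)^*%C))).

Definition beta2 : R := kappa ^+ 2 * (Ainf ^+ 2 + 1).

Definition ahat v phi : R :=
  complex.Re (cintegral Omega (fun x => cdot (mgrad v x) (mgrad phi x))) +
  beta2 * mform Omega v.1 phi.1.

(** [E] is finite and smooth on [H^1] in dimension at most three, so [fine]
    loses nothing. *)
Definition locally_unique u : Prop :=
  forall D : nat -> R -> jet, smooth_curve Omega D -> H1_eq (D 0%N 0) u ->
    (derive1n 2 (fun t => fine (energy (D 0%N t))) 0 = 0 <->
     exists alpha : R, H1_eq (D 1%N 0) (jscale ((alpha%:C)%C * 'i%C) u)).

Definition H1iu u : set jet :=
  [set phi | H1 phi /\ mform Omega (fun x => 'i%C * u.1 x) phi.1 = 0].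

Definition inf_sup u : R :=
  inf [set sup [set energy2 u v phi / (norm v * norm phi) | phi in
                [set phi | H1iu u phi /\ ~ H1_eq phi jzero]] | v in
       [set v | H1iu u v /\ ~ H1_eq v jzero]].

Definition ahat_projection (S : set jet) w (p : jet) : Prop :=
  S p /\ forall phi, S phi -> ahat p phi = ahat w phi.

Definition property_P1 (V : R -> set jet) : Prop :=
  forall phi, H1 phi ->
    (fun h => inf [set H1_norm Omega (jsub phi phih) | phih in V h])
      @ 0^'+ --> (0 : R).

Definition property_P2 (V : R -> set jet) (Capp : R) : Prop :=
  forall u, minimizer u -> forall h, 0 < h ->
  forall w (f : Rd -> C), H1iu u w -> L2 Omega f ->
    (forall phi, H1iu u phi -> ahat w phi = mform Omega f phi.1) ->
  forall p, ahat_projection (V h `&` H1iu u) w p ->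
    norm (jsub w p) <= Capp * h * L2norm Omega f.

End ginzburg_landau.

(* Main.v *)
(** The second derivative of the energy at a minimizer [u] is a nonnegative
    symmetric form [B] on [H^1].  A nonnegative bounded symmetric form whose
    inf-sup constant on a Hilbert space is at least [a] is coercive with the same
    constant [a], since the bottom of its spectrum is an approximate eigenvalue.
    With [a = 1 / Csol], coercivity is inherited by every subspace, and both
    parts follow with constant [1].

    Two analytic inputs are read off the hypotheses.  [H^1] is contained in
    [L^4]: along the line [u + t v] with [v] outside [L^4], the energy is
    infinite for [t <> 0], which [fine] turns into [0]; the formal second
    derivative at [0] then vanishes, and local uniqueness forces [v] to be a
    multiple of [iu], which does lie in [L^4] because the energy of [u] is
    finite.  The form [B] is bounded: the inf-sup hypothesis bounds each
    functional [B v], and the complement of [iu] is complete in the [H^1] norm,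
    so the uniform boundedness principle applies. *)

(* The inf-sup hypothesis bounds each functional [B v] for a reason tied to conventions: a real
   [inf] or [sup] that does not exist has the value 0. A positive lower bound on the outer infimum
   therefore certifies that every inner supremum is finite. Nonnegativity of [B] is what turns
   inf-sup into coercivity. An indefinite form can satisfy an inf-sup condition on the whole space
   and still degenerate on a subspace. Here minimality supplies the sign: the energy is a quartic
   polynomial along each line, and the sum of its values at [u + t v] and [u - t v] contains no odd
   power of [t]. Elements of $H^1$ are compared almost everywhere, so the norm and [B] are only
   semidefinite on jets. The abstract part therefore works with semi-inner products on sets closed
   under linear combinations, and vectors of norm zero are treated apart. For the same reason Gram
   matrices may be singular: the Galerkin system is solvable because the load vector annihilates the
   kernel, and its solution is unique only up to almost everywhere equality. *)
Require Import Defs.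
From HB Require Import structures.
From mathcomp Require Import all_boot all_order all_algebra.
From mathcomp Require Import complex.
From mathcomp Require Import all_classical all_reals all_analysis.
From mathcomp Require Import ess_sup_inf measurable_realfun ring lra.

Set Implicit Arguments.
Unset Strict Implicit.
Unset Printing Implicit Defensive.

Import Order.TTheory GRing.Theory Num.Theory.
Import numFieldNormedType.Exports.

Local Open Scope classical_set_scope.
Local Open Scope ring_scope.

(** * Symmetric forms on a complete semi-inner product space *)

(** For [a > 0] evaluate at the vertex [- b / a]. A negative [a] is impossible, and [a = 0] forces
    [b = 0], since an affine function bounded below is constant. *)
Lemma quad_ge0_discr (R : realFieldType) (a b c : R) :
  (forall t, 0 <= a * t ^+ 2 + 2 * b * t + c) -> b ^+ 2 <= a * c.
Proof.
move=> h.
have c0 : 0 <= c by have := h 0; rewrite expr0n/= !mulr0 !add0r.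
have [a0|a0|a0] := ltgtP a 0.
(* With this [s], the product [a * s] equals [- (2 * |b| + c + 1)], which outweighs the lower order
   terms and makes the polynomial negative at [s + 1]. *)
- pose s := (2 * `|b| + c + 1) / (- a).
  have s0 : 0 <= s by rewrite divr_ge0 ?oppr_ge0 ?(ltW a0)// !addr_ge0 ?mulr_ge0.
  have es : a * s = - (2 * `|b| + c + 1) by rewrite /s; field; rewrite lt_eqF.
  have b0 : 0 <= `|b| by [].
  have bs : 0 <= (s + 1) * (`|b| - b).
    by apply: mulr_ge0; [exact: addr_ge0|rewrite subr_ge0 ler_norm].
  have cs : 0 <= s * c by rewrite mulr_ge0.
  have := h (s + 1).
  have -> : a * (s + 1) ^+ 2 + 2 * b * (s + 1) + c =
    (a * s) * (s + 1) + (a * s) + a + 2 * b * (s + 1) + c by ring.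
  by rewrite es; nra.
- have := h (- b / a).
  have -> : a * (- b / a) ^+ 2 + 2 * b * (- b / a) + c = (a * c - b ^+ 2) / a.
    by field; rewrite gt_eqF.
  by rewrite pmulr_lge0 ?invr_gt0// subr_ge0.
- subst a; rewrite mul0r.
  have [->|b0] := eqVneq b 0; first by rewrite expr0n.
  have := h (- (c + 1) / (2 * b)).
  have -> : 0 * (- (c + 1) / (2 * b)) ^+ 2 + 2 * b * (- (c + 1) / (2 * b)) + c = -1.
    by field.
  by rewrite lerNr oppr0 ler10.
Qed.

Section forms.
Context {R : realType} {V : lmodType R}.
Implicit Types (S : set V) (Q P B : V -> V -> R) (x y z : V).

Definition lin_closed S := S 0 /\ forall (a : R) x y, S x -> S y -> S (a *: x + y).

(** The laws are relative to [S] because the integral forms used later are linear only where their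
    integrands are integrable. *)
Definition sym_form S Q :=
  (forall x y, S x -> S y -> Q x y = Q y x) /\
  (forall (a : R) x y z, S x -> S y -> S z -> Q (a *: x + y) z = a * Q x z + Q y z).

Definition semi_inner S Q := sym_form S Q /\ forall x, S x -> 0 <= Q x x.

Section one_form.
Variables (S : set V) (Q : V -> V -> R).
Hypotheses (hS : lin_closed S) (hQ : sym_form S Q).

Lemma lin_closedD x y : S x -> S y -> S (x + y).
Proof. by move=> Sx Sy; rewrite -[x]scale1r; apply hS.2. Qed.

Lemma lin_closedZ a x : S x -> S (a *: x).
Proof. by move=> Sx; rewrite -[_ *: x]addr0; apply hS.2 => //; exact: hS.1. Qed.

Lemma lin_closedB x y : S x -> S y -> S (x - y).
Proof. by move=> Sx Sy; rewrite addrC -scaleN1r; apply hS.2. Qed.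

Lemma lin_closed_sum (I : Type) (r : seq I) (F : I -> V) :
  (forall i, S (F i)) -> S (\sum_(i <- r) F i).
Proof. by move=> SF; elim/big_ind: _ => //; [exact: hS.1|exact: lin_closedD]. Qed.

Lemma formDl x y z : S x -> S y -> S z -> Q (x + y) z = Q x z + Q y z.
Proof. by move=> Sx Sy Sz; rewrite -[x in LHS]scale1r hQ.2// mul1r. Qed.

Lemma form0l z : S z -> Q 0 z = 0.
Proof.
move=> Sz; have := formDl hS.1 hS.1 Sz; rewrite addr0 => /eqP.
by rewrite -subr_eq subrr eq_sym => /eqP.
Qed.

Lemma formZl a x z : S x -> S z -> Q (a *: x) z = a * Q x z.
Proof.
move=> Sx Sz; rewrite -[_ *: x]addr0 hQ.2//; last exact: hS.1.
by rewrite form0l// addr0.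
Qed.

Lemma formBl x y z : S x -> S y -> S z -> Q (x - y) z = Q x z - Q y z.
Proof.
by move=> Sx Sy Sz; rewrite addrC -scaleN1r hQ.2// mulN1r addrC.
Qed.

Lemma formDr x y z : S x -> S y -> S z -> Q z (x + y) = Q z x + Q z y.
Proof.
move=> Sx Sy Sz; rewrite hQ.1 ?formDl//; last exact: lin_closedD.
by congr (_ + _); rewrite hQ.1.
Qed.

Lemma formZr a x z : S x -> S z -> Q z (a *: x) = a * Q z x.
Proof.
move=> Sx Sz; rewrite hQ.1 ?formZl//; last exact: lin_closedZ.
by rewrite hQ.1.
Qed.

Lemma formBr x y z : S x -> S y -> S z -> Q z (x - y) = Q z x - Q z y.
Proof.
move=> Sx Sy Sz; rewrite hQ.1 ?formBl//; last exact: lin_closedB.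
by congr (_ - _); rewrite hQ.1.
Qed.

Lemma form_suml (I : Type) (r : seq I) (F : I -> V) z :
  (forall i, S (F i)) -> S z -> Q (\sum_(i <- r) F i) z = \sum_(i <- r) Q (F i) z.
Proof.
move=> SF Sz; elim: r => [|i r ih]; first by rewrite !big_nil form0l.
by rewrite !big_cons formDl ?ih//; exact: lin_closed_sum.
Qed.

End one_form.

Section semi_inner_theory.
Variables (S : set V) (Q : V -> V -> R).
Hypotheses (hS : lin_closed S) (hQ : semi_inner S Q).

Lemma form_cauchy_schwarz x y : S x -> S y -> Q x y ^+ 2 <= Q x x * Q y y.
Proof.
move=> Sx Sy; apply: quad_ge0_discr => t.
have Stx := lin_closedZ hS t Sx.
have := hQ.2 (t *: x + y) (hS.2 _ _ _ Sx Sy).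
rewrite hQ.1.2//; last exact: (hS.2).
rewrite !(formDr hS hQ.1)// !(formZr hS hQ.1)// (hQ.1.1 y x)//.
by congr (0 <= _); ring.
Qed.

Definition fnorm x := Num.sqrt (Q x x).

Lemma fnorm_ge0 x : 0 <= fnorm x. Proof. exact: sqrtr_ge0. Qed.

Lemma sqr_fnorm x : S x -> fnorm x ^+ 2 = Q x x.
Proof. by move=> Sx; rewrite sqr_sqrtr// hQ.2. Qed.

Lemma form_le_fnorm x y : S x -> S y -> `|Q x y| <= fnorm x * fnorm y.
Proof.
move=> Sx Sy; rewrite -(@ler_pXn2r _ 2) ?nnegrE ?mulr_ge0 ?fnorm_ge0//.
by rewrite real_normK ?num_real// exprMn !sqr_fnorm// form_cauchy_schwarz.
Qed.

Lemma fnormD x y : S x -> S y -> fnorm (x + y) <= fnorm x + fnorm y.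
Proof.
move=> Sx Sy; have Sxy := lin_closedD hS Sx Sy.
rewrite -(@ler_pXn2r _ 2) ?nnegrE ?addr_ge0 ?fnorm_ge0//.
rewrite sqr_fnorm// (formDl hQ.1)// !(formDr hS hQ.1)// (hQ.1.1 y x)//.
have := form_le_fnorm Sx Sy; have := ler_norm (Q x y).
by rewrite sqrrD !sqr_fnorm//; lra.
Qed.

Lemma fnormZ a x : S x -> fnorm (a *: x) = `|a| * fnorm x.
Proof.
move=> Sx; have Sax := lin_closedZ hS a Sx.
rewrite /fnorm (formZl hS hQ.1)// (formZr hS hQ.1)// mulrA -expr2.
by rewrite sqrtrM ?sqr_ge0// sqrtr_sqr.
Qed.

Lemma fnorm0 : fnorm 0 = 0.
Proof. by rewrite /fnorm (form0l hS hQ.1) ?sqrtr0//; exact: hS.1. Qed.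

End semi_inner_theory.

(* Just the completeness that the gliding hump argument consumes. *)
Definition geom_complete S Q := forall x : nat -> V, (forall n, S (x n)) ->
  (forall n, fnorm Q (x n.+1 - x n) <= 3^-1 ^+ n.+1) ->
  exists2 y, S y & forall e, 0 < e -> exists m, forall n, (m <= n)%N ->
    fnorm Q (y - x n) <= e.


(** * Boundedness and coercivity of nonnegative forms *)

Section bounded_form.
Variables (S : set V) (P B : V -> V -> R).
Hypotheses (hS : lin_closed S) (hP : semi_inner S P) (hB : semi_inner S B).
Local Notation N := (fnorm P).

Section uniform_bound.
Hypothesis sep_bounded : forall v, S v -> exists K, forall w, S w -> B v w <= K * N w.

Let ball := [set w | S w /\ N w <= 1].

Let opn v := sup [set B v w | w in ball].

Let has_sup_opn v : S v -> has_sup [set B v w | w in ball].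
Proof.
move=> Sv; split.
  by exists (B v 0); exists 0 => //; split; rewrite ?(fnorm0 hS hP) ?ler01//; exact: hS.1.
have [K hK] := sep_bounded Sv; exists `|K| => _ [w [Sw w1] <-].
rewrite (le_trans (hK _ Sw))// (le_trans (ler_norm _))// normrM.
by rewrite ler_piMr// ger0_norm// fnorm_ge0.
Qed.

Let opn_ge0 v : S v -> 0 <= opn v.
Proof.
move=> Sv; apply: (ub_le_sup (has_sup_opn Sv).2); exists 0.
  by split; [exact: hS.1|rewrite (fnorm0 hS hP)].
by rewrite hB.1.1 ?(form0l hS hB.1)//; exact: hS.1.
Qed.

Let le_opn v w : S v -> S w -> B v w <= opn v * N w.
Proof.
move=> Sv Sw; have [Nw0|Nw0] := eqVneq (N w) 0.
  have [K hK] := sep_bounded Sv.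
  by rewrite Nw0 mulr0 (le_trans (hK _ Sw))// Nw0 mulr0.
have {}Nw0 : 0 < N w by rewrite lt_neqAle eq_sym Nw0 fnorm_ge0.
have Sw' := lin_closedZ hS (N w)^-1 Sw.
rewrite -ler_pdivrMr// mulrC -(formZr hS hB.1)//.
apply: (ub_le_sup (has_sup_opn Sv).2); exists ((N w)^-1 *: w) => //.
split=> //; rewrite (fnormZ hS hP)// gtr0_norm ?invr_gt0//.
by rewrite mulVf// gt_eqF.
Qed.

Let norm_le_opn v w : S v -> S w -> `|B v w| <= opn v * N w.
Proof.
move=> Sv Sw; rewrite ler_norml le_opn// andbT lerNl.
have Sw' := lin_closedZ hS (-1) Sw.
have := le_opn Sv Sw'.
by rewrite (formZr hS hB.1)// mulN1r (fnormZ hS hP)// normrN1 mul1r.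
Qed.

(** The factor $1/2$ is the sum of the series $\sum_{k\ge1} 3^{-k}$. That it stays below $3/4$ is
    what the gliding hump needs. *)
Lemma geom_tail (x : nat -> V) y : (forall n, S (x n)) -> S y ->
  (forall n, N (x n.+1 - x n) <= 3^-1 ^+ n.+1) ->
  (forall e, 0 < e -> exists m, forall n, (m <= n)%N -> N (y - x n) <= e) ->
  forall n, N (y - x n) <= 2^-1 * 3^-1 ^+ n.
Proof.
move=> Sx Sy dx ylim n; apply/ler_addgt0Pr => e e0.
have [m hm] := ylim _ e0.
have tail k : N (x (n + k)%N - x n) <= 2^-1 * (3^-1 ^+ n - 3^-1 ^+ (n + k)).
  elim: k => [|k ih]; first by rewrite addn0 !subrr mulr0 (fnorm0 hS hP).
  have -> : x (n + k.+1)%N - x n = (x (n + k).+1 - x (n + k)%N) + (x (n + k)%N - x n).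
    by rewrite addrA subrK addnS.
  apply: (le_trans (fnormD hS hP _ _)); [exact: lin_closedB|exact: lin_closedB|].
  apply: (le_trans (lerD (dx _) ih)).
  by rewrite addnS exprS; lra.
have -> : y - x n = (y - x (n + m)%N) + (x (n + m)%N - x n) by rewrite addrA subrK.
apply: (le_trans (fnormD hS hP _ _)); [exact: lin_closedB|exact: lin_closedB|].
rewrite addrC lerD//; last by rewrite hm// leq_addl.
apply: (le_trans (tail m)); by rewrite ler_pM2l// gerBl exprn_ge0.
Qed.

(* Hellinger-Toeplitz, by the gliding hump of Sokal's proof of the uniform
   boundedness principle, applied to the functionals [B v] with [N v <= 1]. *)
Lemma separately_bounded_form : geom_complete S P ->
  exists2 M, 0 < M & forall v, S v -> B v v <= M * P v v.
Proof.
move=> complete; have [[M M0 hM]|unb] := pselect (exists2 M, 0 < M &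
    forall v, S v -> N v <= 1 -> opn v <= M).
  exists M => // v Sv; have [Nv0|Nv0] := eqVneq (N v) 0.
    rewrite -(sqr_fnorm hP)// Nv0 expr0n mulr0.
    by rewrite (le_trans (le_opn Sv Sv))// Nv0 mulr0.
  have {}Nv0 : 0 < N v by rewrite lt_neqAle eq_sym Nv0 fnorm_ge0.
  have Sv' := lin_closedZ hS (N v)^-1 Sv.
  have Nv'1 : N ((N v)^-1 *: v) = 1.
    by rewrite (fnormZ hS hP)// gtr0_norm ?invr_gt0// mulVf// gt_eqF.
  have : B ((N v)^-1 *: v) ((N v)^-1 *: v) <= M.
    by rewrite (le_trans (le_opn Sv' Sv'))// Nv'1 mulr1 hM ?Nv'1.
  rewrite (formZl hS hB.1)// (formZr hS hB.1)// mulrA -expr2 exprVn.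
  by rewrite mulrC ler_pdivrMr ?exprn_gt0// (sqr_fnorm hP).
(* The growth rate 4 beats the step lengths $3^{-n}$, so the humps grow like $(4/3)^n$. *)
have /choice[v hv] : forall n : nat, exists v, [/\ S v, N v <= 1 & 4 ^+ n < opn v].
  move=> n; apply: contrapT => h; apply: unb; exists (4 ^+ n) => [|v Sv v1].
    by rewrite exprn_gt0.
  by rewrite leNgt; apply/negP => vn; apply: h; exists v.
have Sv n : S (v n) by have [] := hv n.
have opn0 n : 0 < opn (v n).
  by have [_ _] := hv n; apply: lt_trans; rewrite exprn_gt0.
have /choice[w hw] : forall n : nat, exists w,
    [/\ S w, N w <= 1 & 3 / 4 * opn (v n) <= B (v n) w].
  move=> n; have e0 : 0 < opn (v n) / 4 by rewrite divr_gt0.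
  have [_ [w [Sw w1] <-] h] := sup_adherent e0 (has_sup_opn (Sv n)).
  by exists w; split => //; move: h; rewrite -/(opn _); lra.
have Sw n : S (w n) by have [] := hw n.
(* The sign makes the new increment reinforce the value of [B (v n)] on the partial sum, so nothing
   cancels. *)
pose s n z : R := if 0 <= B (v n) z then 1 else -1.
pose x := fix x n := if n is m.+1 then x m + (s n (x m) * 3^-1 ^+ n) *: w n else 0.
have Sx n : S (x n).
  elim: n => [|n ih]; first exact: hS.1.
  by rewrite /=; apply: lin_closedD => //; exact: lin_closedZ.
have dx n : N (x n.+1 - x n) <= 3^-1 ^+ n.+1.
  rewrite /= addrC addKr (fnormZ hS hP)// normrM.
  have -> : `|s n.+1 (x n)| = 1 by rewrite /s; case: ifP => _; rewrite ?normrN1 ?normr1.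
  rewrite mul1r ger0_norm ?exprn_ge0 ?invr_ge0//.
  by rewrite ler_piMr ?exprn_ge0 ?invr_ge0//; have [] := hw n.+1.
have hump n : 3 / 4 * opn (v n.+1) * 3^-1 ^+ n.+1 <= `|B (v n.+1) (x n.+1)|.
  have [_ _ h] := hw n.+1.
  set r : R := 3^-1 ^+ n.+1.
  have r0 : 0 <= r by rewrite exprn_ge0// invr_ge0.
  have {}h := ler_wpM2r r0 h; apply: (le_trans h).
  rewrite /= (formDr hS hB.1)//; last exact: lin_closedZ.
  rewrite (formZr hS hB.1)// -/r /s; case: ifPn => [b0|].
    by rewrite mul1r mulrC (le_trans _ (ler_norm _))// lerDr.
  rewrite -ltNge => b0.
  by rewrite -normrN (le_trans _ (ler_norm _))//; lra.
have [y Sy ylim] := complete x Sx dx.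
have ty := geom_tail Sx Sy dx ylim.
(* The hump secures $3/4$ of [opn (v n.+1)] times $3^{-(n+1)}$, the tail costs at most $1/2$ of it,
   and $1/4$ remains. *)
have big n : 4^-1 * (4 / 3) ^+ n.+1 <= opn y.
  (* Symmetry enters here: the functionals [B (v n.+1)] at the fixed [y] are values of the single
     functional [B y] on the unit ball, hence uniformly bounded. *)
  have yv : `|B (v n.+1) y| <= opn y.
    rewrite hB.1.1// (le_trans (norm_le_opn _ _))//.
    have [_ v1 _] := hv n.+1; rewrite ler_piMr//.
    exact: opn_ge0.
  apply: (le_trans _ yv).
  have -> : y = x n.+1 + (y - x n.+1) by rewrite addrC subrK.
  have Syx := lin_closedB hS Sy (Sx n.+1).
  rewrite (formDr hS hB.1)//.
  have h1 := hump n; have h2 := norm_le_opn (Sv n.+1) Syx.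
  have h3 := ler_wpM2l (ltW (opn0 n.+1)) (ty n.+1).
  have h4 := lerB_dist (B (v n.+1) (x n.+1)) (- B (v n.+1) (y - x n.+1)).
  rewrite opprK normrN in h4.
  have [_ _ h5] := hv n.+1.
  have r0 : 0 <= 3^-1 ^+ n.+1 :> R by rewrite exprn_ge0// invr_ge0.
  have := ler_wpM2r r0 (ltW h5).
  rewrite -exprMn; move: h1 h2 h3 h4; set r := 3^-1 ^+ n.+1; set o := opn _.
  by set q := (4 / 3) ^+ _; lra.
have grow n : n%:R / 3 <= (4 / 3) ^+ n :> R.
  suff : 1 + n%:R / 3 <= (4 / 3) ^+ n :> R by apply: le_trans; rewrite lerDr.
  elim: n => [|n ih]; first by rewrite mul0r addr0 expr0.
  have n0 : 0 <= n%:R :> R by [].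
  by rewrite exprS -natr1; nra.
have oy0 := opn_ge0 Sy.
(* The 12 is $4\cdot 3$: the factor $1/4$ of [big] times the $1/3$ in the linear lower bound
   [grow]. *)
pose n := Num.truncn (12 * opn y).
have := grow n.+1; have := big n; have : 12 * opn y < n.+1%:R.
  by rewrite truncnS_gt.
lra.
Qed.

End uniform_bound.

(* The bottom [l] of the spectrum of [B] is an approximate eigenvalue: on a
   minimizing sequence of the quotient [B v v / P v v], the functionals [B v]
   and [l *: P v] merge. *)
Lemma inf_sup_coercive (a M : R) : 0 < M -> (forall v, S v -> B v v <= M * P v v) ->
  (forall v K, S v -> 0 < N v -> (forall w, S w -> B v w <= K * N v * N w) -> a <= K) ->
  forall v, S v -> a * P v v <= B v v.
Proof.
move=> M0 hM ha v0 Sv0; rewrite leNgt; apply/negP => lt_a.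
have B0 := hB.2 _ Sv0; have P0 := hP.2 _ Sv0.
have Pv0 : 0 < P v0 v0.
  rewrite lt_neqAle P0 andbT eq_sym; apply/eqP => h.
  by move: lt_a; rewrite h mulr0 ltNge B0.
pose E := [set B v v / P v v | v in [set v | S v /\ 0 < P v v]].
have E0 : lbound E 0 by move=> _ [v [Sv Pv] <-]; rewrite divr_ge0 ?hB.2// ltW.
have hE : has_inf E by split; [exists (B v0 v0 / P v0 v0); exists v0|exists 0].
pose l := inf E.
have l0 : 0 <= l by apply: lb_le_inf => //; exact: hE.1.
have la : l < a.
  apply: (@le_lt_trans _ _ (B v0 v0 / P v0 v0)); last by rewrite ltr_pdivrMr.
  by apply: (ge_inf hE.2); exists v0.
pose Q x y := B x y - l * P x y.
have hQ : semi_inner S Q.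
  split; first split.
  - by move=> x y Sx Sy; rewrite /Q hB.1.1// hP.1.1.
  - by move=> c x y z Sx Sy Sz; rewrite /Q hB.1.2// hP.1.2//; ring.
  - move=> x Sx; rewrite /Q subr_ge0; have := hP.2 _ Sx.
    rewrite le_eqVlt => /predU1P[<-|Px]; first by rewrite mulr0 hB.2.
    by rewrite -ler_pdivlMr//; apply: (ge_inf hE.2); exists x.
(* Chosen so that [e * M] is the square of [(a - l) / 2]. Cauchy-Schwarz for [Q] then bounds [Q v w]
   by [(a - l) / 2 * N v * N w], and the quotient bound becomes the midpoint of [l] and [a], below
   [a]. *)
pose e := ((a - l) / 2) ^+ 2 / M.
have al : 0 < (a - l) / 2 by rewrite divr_gt0// subr_gt0.
have e0 : 0 < e by rewrite divr_gt0// exprn_gt0.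
have [_ [v [Sv Pv] <-]] := inf_adherent e0 hE.
rewrite -/l ltr_pdivrMr// => hv.
have Qv : Q v v <= e * P v v by rewrite /Q; lra.
have Nv : 0 < N v by rewrite sqrtr_gt0.
suff : a <= l + (a - l) / 2 by lra.
apply: (ha v) => // w Sw.
have -> : B v w = l * P v w + Q v w by rewrite /Q; ring.
have h1 : P v w <= N v * N w by rewrite (le_trans (ler_norm _))// (form_le_fnorm hS hP).
suff h2 : Q v w <= (a - l) / 2 * N v * N w.
  have -> : (l + (a - l) / 2) * N v * N w = l * (N v * N w) + (a - l) / 2 * N v * N w.
    by ring.
  by rewrite lerD// ler_wpM2l.
have Pw := hP.2 _ Sw.
apply: (le_trans (ler_norm _)); rewrite -(@ler_pXn2r _ 2) ?nnegrE//; last first.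
  by rewrite !mulr_ge0 ?fnorm_ge0// ?invr_ge0// subr_ge0 ltW.
rewrite real_normK ?num_real// (le_trans (form_cauchy_schwarz hS hQ Sv Sw))//.
have Qw : Q w w <= M * P w w.
  by rewrite /Q lerBlDr (le_trans (hM _ Sw))// lerDl mulr_ge0.
rewrite !exprMn (sqr_fnorm hP)// (sqr_fnorm hP)//.
apply: (le_trans (ler_pM (hQ.2 _ Sv) (hQ.2 _ Sw) Qv Qw)).
by rewrite /e exprMn le_eqVlt; apply/orP; left; apply/eqP; field; rewrite gt_eqF.
Qed.

End bounded_form.

(** The family [e] may be dependent and [B] degenerate, so the Gram matrix need not be invertible. A
    coefficient vector in its kernel gives an element with [B x x = 0], on which [f] vanishes; this
    is the solvability condition of the linear system. *)
Lemma galerkin_solution (S : set V) (B : V -> V -> R) (f : V -> R) (n : nat) (e : 'I_n -> V) :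
  lin_closed S -> semi_inner S B ->
  (forall (a : R) x y, S x -> S y -> f (a *: x + y) = a * f x + f y) ->
  (forall x, S x -> B x x = 0 -> f x = 0) -> (forall i, S (e i)) ->
  exists c : 'I_n -> R, forall i, B (\sum_j c j *: e j) (e i) = f (e i).
Proof.
move=> hS hB hf f0 Se.
have Sc (c : 'I_n -> R) : S (\sum_j c j *: e j).
  by apply: lin_closed_sum => // j; exact: lin_closedZ.
pose G := \matrix_(i, j) B (e i) (e j).
pose F := \row_i f (e i).
have fsum (c : 'I_n -> R) : f (\sum_j c j *: e j) = \sum_j c j * f (e j).
  have f00 : f 0 = 0 by apply: f0; [exact: hS.1|rewrite (form0l hS hB.1)//; exact: hS.1].
  have [] : S (\sum_j c j *: e j) /\ f (\sum_j c j *: e j) = \sum_j c j * f (e j).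
    elim: (index_enum _) => [|i r [Sr ih]].
      by rewrite !big_nil; split; first exact: hS.1.
    by rewrite !big_cons hf// ih; split=> //; exact: hS.2.
  by [].
(* Row-space membership is tested against the cokernel: each column [z] satisfies $Gz = 0$, hence
   $z^T G z = 0$. *)
have /submxP[c hc] : (F <= G)%MS.
  rewrite submxE; apply/eqP/matrixP => i j; rewrite mxE [in RHS]mxE.
  pose z k := cokermx G k j.
  transitivity (f (\sum_k z k *: e k)).
    by rewrite fsum; apply: eq_bigr => k _; rewrite mxE mulrC.
  apply: f0 => //; rewrite (form_suml hS hB.1)//; last by move=> k; exact: lin_closedZ.
  apply: big1 => k _; rewrite (formZl hS hB.1)// hB.1.1//.
  rewrite (form_suml hS hB.1)//; last by move=> l; exact: lin_closedZ.
  rewrite [X in _ * X](_ : _ = 0) ?mulr0//.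
  have /matrixP/(_ k j) := mulmx_coker G; rewrite mxE [RHS]mxE => Gz.
  rewrite -[RHS]Gz; apply: eq_bigr => l _; rewrite (formZl hS hB.1)// mxE mulrC.
  by rewrite hB.1.1.
exists (c ord0) => i.
have /matrixP/(_ ord0 i) := hc; rewrite !mxE => ->.
rewrite (form_suml hS hB.1)//; last by move=> l; exact: lin_closedZ.
by apply: eq_bigr => l _; rewrite (formZl hS hB.1)// mxE.
Qed.

End forms.

(** * Square integrable functions *)

Section square_integrable.
Context {disp : measure_display} {T : measurableType disp} {R : realType}.
Variables (mu : {measure set T -> \bar R}) (D : set T).
Hypothesis mD : measurable D.
Implicit Types (f g : T -> R).

Definition sqint f := measurable_fun D f /\
  mu.-integrable D (EFin \o (fun x => f x ^+ 2)).

Lemma le_integrableR f g : measurable_fun D f ->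
  (forall x, D x -> `|f x| <= g x) -> mu.-integrable D (EFin \o g) ->
  mu.-integrable D (EFin \o f).
Proof.
move=> mf fg; apply: le_integrable => //; first exact/measurable_EFinP.
by move=> x Dx /=; rewrite lee_fin (le_trans (fg _ Dx))// ler_norm.
Qed.

Lemma integrableDR f g : mu.-integrable D (EFin \o f) -> mu.-integrable D (EFin \o g) ->
  mu.-integrable D (EFin \o (fun x => f x + g x)).
Proof. by move=> fi gi; have := integrableD mD fi gi; exact: eq_integrable. Qed.

Lemma integrableZR a f : mu.-integrable D (EFin \o f) ->
  mu.-integrable D (EFin \o (fun x => a * f x)).
Proof. by move=> fi; have := integrableZl mD a fi; exact: eq_integrable. Qed.

Lemma Rintegral_sum (I : Type) (r : seq I) (F : I -> T -> R) :
  (forall i, mu.-integrable D (EFin \o F i)) ->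
  mu.-integrable D (EFin \o (fun x => \sum_(i <- r) F i x)) /\
  \int[mu]_(x in D) (\sum_(i <- r) F i x) = \sum_(i <- r) \int[mu]_(x in D) F i x.
Proof.
move=> Fi; elim: r => [|i r [ih1 ih2]].
  rewrite big_nil (_ : (fun x => _) = fun=> 0); last by apply/funext => x; rewrite big_nil.
  by rewrite Rintegral_cst// mul0r; split => //; exact: integrable0.
rewrite big_cons -ih2 -RintegralD//.
rewrite (_ : (fun x => _) = (fun x => F i x + \sum_(j <- r) F j x)); last first.
  by apply/funext => x; rewrite big_cons.
by split => //; exact: integrableDR.
Qed.

Lemma sqintM f g : sqint f -> sqint g -> mu.-integrable D (EFin \o (fun x => f x * g x)).
Proof.
move=> [mf fi] [mg gi].
apply: (@le_integrableR _ (fun x => f x ^+ 2 + g x ^+ 2)).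
- exact: measurable_funM.
- move=> x _; rewrite ler_norml; have := sqr_ge0 (f x + g x).
  by have := sqr_ge0 (f x - g x); nra.
- exact: integrableDR.
Qed.

Lemma sqint_le f g : measurable_fun D f -> (forall x, D x -> `|f x| <= `|g x|) ->
  sqint g -> sqint f.
Proof.
move=> mf fg [mg gi]; split => //; apply: le_integrableR gi.
  exact: measurable_funX.
move=> x Dx; rewrite ger0_norm ?sqr_ge0// -[f x ^+ 2]real_normK ?num_real//.
by rewrite -[leRHS]real_normK ?num_real// ler_pXn2r ?nnegrE ?fg.
Qed.

Lemma sqintD f g : sqint f -> sqint g -> sqint (fun x => f x + g x).
Proof.
move=> hf hg; split; first exact: measurable_funD hf.1 hg.1.
apply: (@le_integrableR _ (fun x => 2 * (f x ^+ 2 + g x ^+ 2))).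
- by apply: measurable_funX; exact: measurable_funD hf.1 hg.1.
- move=> x _; rewrite ger0_norm ?sqr_ge0//.
  by have := sqr_ge0 (f x - g x); nra.
- by apply: integrableZR; apply: integrableDR; [exact: hf.2|exact: hg.2].
Qed.

Lemma sqintZ a f : sqint f -> sqint (fun x => a * f x).
Proof.
move=> hf; split; first exact: measurable_funM hf.1.
rewrite (_ : _ \o _ = EFin \o (fun x => a ^+ 2 * f x ^+ 2)).
  exact: integrableZR hf.2.
by apply/funext => x /=; rewrite exprMn.
Qed.

Lemma sqintN f : sqint f -> sqint (fun x => - f x).
Proof.
move=> /(sqintZ (-1)); rewrite (_ : (fun x => _) = (fun x => - f x))//.
by apply/funext => x; rewrite mulN1r.
Qed.

Lemma sqintB f g : sqint f -> sqint g -> sqint (fun x => f x - g x).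
Proof. by move=> hf hg; apply: sqintD => //; exact: sqintN. Qed.

Lemma sqint0 : sqint (fun=> 0).
Proof.
split; first exact: measurable_cst.
rewrite (_ : _ \o _ = cst 0%E); first exact: integrable0.
by apply/funext => x /=; rewrite expr0n.
Qed.

(** Needed for products with components of the field [A], whose bound is only essential, so
    integrals are compared almost everywhere. *)
Lemma sqint_ae_bounded K f g : measurable_fun D g ->
  {ae mu, forall x, D x -> `|g x| <= K} -> sqint f -> sqint (fun x => g x * f x).
Proof.
move=> mg gK [mf fi]; split; first exact: measurable_funM.
apply/integrableP; split.
  by apply/measurable_EFinP; apply: measurable_funX; exact: measurable_funM.
have KK : (\int[mu]_(x in D) (K ^+ 2 * f x ^+ 2)%:E < +oo)%E.
  have /integrableP[_] := integrableZR (K ^+ 2) fi.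
  apply: le_lt_trans; apply: ge0_le_integral => //.
  - by move=> x _; rewrite lee_fin mulr_ge0 ?sqr_ge0.
  - apply/measurable_EFinP; apply: measurable_funM => //; exact: measurable_funX.
  - apply/measurableT_comp => //; apply/measurable_EFinP.
    by apply: measurable_funM => //; exact: measurable_funX.
  - by move=> x _ /=; rewrite lee_fin ler_norm.
apply: le_lt_trans KK; apply: ae_ge0_le_integral => //.
- apply/measurableT_comp => //; apply/measurable_EFinP.
  by apply: measurable_funX; exact: measurable_funM.
- by move=> x _; rewrite lee_fin mulr_ge0 ?sqr_ge0.
- by apply/measurable_EFinP; apply: measurable_funM => //; exact: measurable_funX.
- apply: filterS gK => x h Dx; have {}h := h Dx.
  rewrite /= lee_fin ger0_norm ?sqr_ge0// exprMn ler_wpM2r ?sqr_ge0//.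
  by rewrite -[leLHS]real_normK ?num_real// ler_pXn2r ?nnegrE// (le_trans _ h).
Qed.

Lemma sqint_bounded K g : (mu D < +oo)%E -> measurable_fun D g ->
  (forall x, D x -> `|g x| <= K) -> sqint g.
Proof.
move=> muD mg gK; split => //; apply: (@le_integrableR _ (fun=> K ^+ 2)).
- exact: measurable_funX.
- move=> x Dx; rewrite ger0_norm ?sqr_ge0// -[leLHS]real_normK ?num_real//.
  by rewrite ler_pXn2r ?nnegrE ?gK// (le_trans _ (gK _ Dx)).
- apply/integrableP; split; first exact/measurable_EFinP/measurable_cst.
  by rewrite integral_cst//= lte_mul_pinfty.
Qed.

Definition dotI f g := \int[mu]_(x in D) (f x * g x).

Lemma dotI_semi_inner : semi_inner (V := T -> R^o) [set f | sqint f] dotI.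
Proof.
split; first split.
- by move=> f g _ _; apply: eq_Rintegral => x _; rewrite mulrC.
- move=> a f g h sf sg sh; rewrite /dotI -RintegralZl//; last exact: sqintM.
  rewrite -RintegralD//; last 2 first.
  - by apply: integrableZR; exact: sqintM.
  - exact: sqintM.
  by apply: eq_Rintegral => x _; rewrite mulrDl mulrA.
- by move=> f _; apply: Rintegral_ge0 => x _; rewrite -expr2 sqr_ge0.
Qed.

Lemma sqint_lin_closed : lin_closed (V := T -> R^o) [set f | sqint f].
Proof.
split; first exact: sqint0.
by move=> a f g sf sg; apply: sqintD => //; exact: sqintZ.
Qed.

Lemma dotI_cauchy_schwarz f g : sqint f -> sqint g ->
  dotI f g ^+ 2 <= dotI f f * dotI g g.
Proof.
exact: (form_cauchy_schwarz sqint_lin_closed dotI_semi_inner).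
Qed.

End square_integrable.

(** The intervals of centre [a n] and radius [2 * s * 2^-1 ^+ n] are nested, because a step uses up
    exactly half of the radius. The supremum of the left ends lies in all of them. *)
Lemma geometric_steps_limit (R : realType) (a : nat -> R) (s : R) : 0 <= s ->
  (forall n, `|a n.+1 - a n| <= s * 2^-1 ^+ n) ->
  exists l, forall n, `|l - a n| <= 2 * s * 2^-1 ^+ n.
Proof.
move=> s0 da; pose lo n := a n - 2 * s * 2^-1 ^+ n; pose up n := a n + 2 * s * 2^-1 ^+ n.
have step n : lo n <= lo n.+1 /\ up n.+1 <= up n.
  by have := da n; rewrite ler_norml /lo /up exprS; split; lra.
have lo_mono m n : (m <= n)%N -> lo m <= lo n.
  move=> /subnK<-; elim: (n - m)%N => [//|k ih].
  by rewrite addSn (le_trans ih)//; have [] := step (k + m)%N.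
have up_mono m n : (m <= n)%N -> up n <= up m.
  move=> /subnK<-; elim: (n - m)%N => [//|k ih].
  by rewrite addSn (le_trans _ ih)//; have [] := step (k + m)%N.
have lo_up m n : lo m <= up n.
  rewrite (le_trans (lo_mono _ _ (leq_maxl m n)))//.
  rewrite (le_trans _ (up_mono _ _ (leq_maxr m n)))// /lo /up.
  rewrite lerD2l (@le_trans _ _ 0)// ?oppr_le0; by rewrite !mulr_ge0.
exists (sup (range lo)) => n.
have ub : has_ubound (range lo) by exists (up 0%N) => _ [m _ <-].
have h1 : lo n <= sup (range lo) by apply: ub_le_sup => //; exists n.
have h2 : sup (range lo) <= up n by apply: ge_sup => [|_ [m _ <-]//]; exists (lo 0%N), 0%N.
by rewrite ler_norml; move: h1 h2; rewrite /lo /up => h1 h2; apply/andP; split; lra.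
Qed.

Lemma geometric_small (R : realType) (K e : R) : 0 <= K -> 0 < e ->
  exists m, forall n, (m <= n)%N -> K * 4^-1 ^+ n <= e.
Proof.
move=> K0 e0; exists (Num.truncn (K / e)) => n mn.
have n4 : n.+1%:R <= 4 ^+ n :> R.
  elim: n {mn} => [//|n ih]; rewrite exprS -natr1.
  have : 1 <= n.+1%:R :> R by rewrite ler1n.
  by lra.
rewrite exprVn ler_pdivrMr ?exprn_gt0// mulrC -ler_pdivrMr//.
by rewrite (le_trans (ltW (truncnS_gt _)))// (le_trans _ n4)// ler_nat.
Qed.

(** * Completeness of $L^2$ along geometrically converging sequences *)

Section completeness.
Context {disp : measure_display} {T : measurableType disp} {R : realType}.
Variables (mu : {measure set T -> \bar R}) (D : set T).
Hypothesis mD : measurable D.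

(* With the weights [4 ^+ n], the sum [S] of the squared steps is integrable, and
   wherever [S] is finite the steps are at most [sqrt S * 2^-n]. *)
Lemma sqint_complete (K : R) (f : nat -> T -> R) : (forall n, sqint mu D (f n)) ->
  (forall n, dotI mu D (fun x => f n.+1 x - f n x) (fun x => f n.+1 x - f n x) <=
             K * 9^-1 ^+ n) ->
  exists2 g, sqint mu D g & forall e, 0 < e -> exists m, forall n, (m <= n)%N ->
    dotI mu D (fun x => g x - f n x) (fun x => g x - f n x) <= e.
Proof.
move=> sf df.
pose d n x : R := 4 ^+ n * (f n.+1 x - f n x) ^+ 2.
have half2 : 2^-1 ^+ 2 = 4^-1 :> R by field.
have K0 : 0 <= K.
  have := df 0%N; rewrite expr0 mulr1; apply: le_trans.
  by apply: Rintegral_ge0 => x _; rewrite -expr2 sqr_ge0.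
have d0 n x : 0 <= d n x by rewrite mulr_ge0 ?sqr_ge0 ?exprn_ge0.
have sd n : sqint mu D (fun x => f n.+1 x - f n x) by exact: sqintB.
have di n : mu.-integrable D (EFin \o d n).
  by apply: integrableZR => //; exact: (sd n).2.
have md n : measurable_fun D (EFin \o d n) by have /integrableP[] := di n.
pose S x := (\sum_(0 <= n <oo) (d n x)%:E)%E.
have S0 x : (0 <= S x)%E by apply: nneseries_ge0 => n _ _; rewrite lee_fin.
have mS : measurable_fun D S.
  by apply: (@ge0_emeasurable_sum _ _ _ _ _ xpredT) => [n x _ _|n _];
    [rewrite lee_fin; exact: d0|exact: md].
have intd n : (\int[mu]_(x in D) (d n x)%:E)%E = (\int[mu]_(x in D) d n x)%:E.
  by rewrite /Rintegral fineK//; exact: integrable_fin_num (di n).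
have IS : (\int[mu]_(x in D) S x <= (2 * K)%:E)%E.
  rewrite /S integral_nneseries//; last by move=> n x _; rewrite lee_fin.
  apply: lime_le.
    apply: is_cvg_nneseries => n _ _; apply: integral_ge0 => x _; by rewrite lee_fin.
  apply: nearW => n; rewrite (eq_bigr _ (fun i _ => intd i)) sumEFin lee_fin.
  have step i : \int[mu]_(x in D) d i x <= K * (4 / 9) ^+ i.
    rewrite /d RintegralZl//; last exact: (sd i).2.
    rewrite exprMn mulrCA ler_wpM2l ?exprn_ge0//.
    by have := df i; rewrite /dotI.
  (* The series of ratio $4/9$ sums to $9/5$; rounding to 2 gives a bound whose induction closes
     directly. *)
  apply: (@le_trans _ _ (2 * K * (1 - (4 / 9) ^+ n))).
    elim: n => [|n ih]; first by rewrite big_nil expr0 subrr mulr0.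
    rewrite big_nat_recr//= (le_trans (lerD ih (step n)))// exprS.
    have : 0 <= (4 / 9) ^+ n :> R by rewrite exprn_ge0// divr_ge0.
    by nra.
  by rewrite ler_piMr ?mulr_ge0// gerBl exprn_ge0// divr_ge0.
have Si : mu.-integrable D S.
  apply/integrableP; split => //.
  under eq_integral do rewrite gee0_abs//.
  by rewrite (le_lt_trans IS)// ltry.
pose E := D `&` [set x | (S x < +oo)%E].
have mE : measurable E by exact: emeasurable_fun_infty_o.
have /choice[g hg] : forall x, exists l,
    (E x -> forall n, (l - f n x) ^+ 2 <= 4 * 4^-1 ^+ n * fine (S x)) /\
   (~ E x -> l = 0).
  move=> x; have [Ex|nEx] := pselect (E x); last by exists 0.
  have [s Ss s0] : exists2 s, S x = s%:E & 0 <= s.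
    move: (S0 x) (Ex.2) => /=; case: (S x) => // s s0 _; by exists s.
  have ds n : d n x <= s.
    rewrite -lee_fin -Ss (le_trans _ (nneseries_lim_ge n.+1 _))//.
      rewrite sumEFin lee_fin big_nat_recr//= lerDr sumr_ge0//.
    by move=> i _ _; rewrite lee_fin.
  have [] := @geometric_steps_limit _ (f ^~ x) (Num.sqrt s) (sqrtr_ge0 _).
    move=> n; rewrite -(@ler_pXn2r _ 2) ?nnegrE ?mulr_ge0 ?sqrtr_ge0//.
    rewrite real_normK ?num_real// exprMn sqr_sqrtr//.
    have := ds n; rewrite /d -ler_pdivlMl ?exprn_gt0//.
    rewrite -exprM mulnC exprM -[X in _ * X ^+ n]/(2^-1 ^+ 2) => /le_trans; apply.
    by rewrite mulrC -exprVn ler_wpM2l//; rewrite half2.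
  move=> l hl; exists l; split => // _ n; rewrite Ss /=.
  rewrite -[leLHS]real_normK ?num_real//.
  apply: (@le_trans _ _ ((2 * Num.sqrt s * 2^-1 ^+ n) ^+ 2)).
    by rewrite ler_pXn2r ?nnegrE ?mulr_ge0 ?sqrtr_ge0.
  rewrite !exprMn sqr_sqrtr// -!exprM [(n * 2)%N]mulnC exprM.
  by rewrite half2 le_eqVlt; apply/orP; left; apply/eqP; ring.
have mg : measurable_fun D g.
  (* Cutting off outside [E] makes the sequence converge at every point, to 0 where [S] is infinite.
     This matches the value given to [g] there. *)
  apply: (@measurable_fun_cvg _ _ _ _ (fun n x => f n x * \1_E x)).
    move=> n; apply: measurable_funM; first exact: (sf n).1.
    exact: measurable_indic.
  move=> x Dx; have [Ex|nEx] := pselect (E x); last first.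
    rewrite (hg x).2//; rewrite (_ : (fun n => _) = cst 0); first exact: cvg_cst.
    by apply/funext => n; rewrite indicE memNset// mulr0.
  apply/cvgrPdist_le => e e0.
  have [m hm] : exists m, forall n, (m <= n)%N -> 4 * 4^-1 ^+ n * fine (S x) <= e ^+ 2.
    have [||m hm] := @geometric_small _ (4 * fine (S x)) (e ^+ 2).
    - by rewrite mulr_ge0// fine_ge0.
    - by rewrite exprn_gt0.
    by exists m => n /hm; rewrite mulrAC.
  exists m => // n /= mn; rewrite indicE mem_set// mulr1.
  rewrite -(@ler_pXn2r _ 2) ?nnegrE ?(ltW e0)// real_normK ?num_real//.
  by rewrite (le_trans ((hg x).1 Ex n))// hm.
have sqS n : (\int[mu]_(x in D) ((g x - f n x) ^+ 2)%:E <= (8 * K * 4^-1 ^+ n)%:E)%E.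
  have mgf : measurable_fun D (fun x => (g x - f n x) ^+ 2).
    by apply: measurable_funX; apply: measurable_funB => //; exact: (sf n).1.
  apply: (@le_trans _ _ (\int[mu]_(x in D) ((4 * 4^-1 ^+ n)%:E * S x))%E).
    apply: ae_ge0_le_integral => //.
    - by move=> x _; rewrite lee_fin sqr_ge0.
    - exact/measurable_EFinP.
    - by move=> x _; rewrite mule_ge0// lee_fin mulr_ge0 ?exprn_ge0.
    - exact: measurable_funeM.
    have := integrable_ae mD Si; apply: filterS => x fS Dx.
    have {}fS := fS Dx; have Ex : E x by split=> //; rewrite /= ltey_eq fS.
    by rewrite -[S x]fineK// -EFinM lee_fin; exact: (hg x).1.
  rewrite ge0_integralZl// ?lee_fin ?mulr_ge0 ?exprn_ge0//.
  apply: (le_trans (lee_wpmul2l _ IS)); first by rewrite lee_fin mulr_ge0 ?exprn_ge0.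
  by rewrite -EFinM lee_fin; lra.
have sgf n : sqint mu D (fun x => g x - f n x).
  have mgf : measurable_fun D (fun x => g x - f n x).
    by apply: measurable_funB => //; exact: (sf n).1.
  split=> //; apply/integrableP; split.
    by apply/measurable_EFinP; exact: measurable_funX.
  under eq_integral do rewrite gee0_abs ?lee_fin ?sqr_ge0//.
  by rewrite (le_lt_trans (sqS n))// ltry.
exists g.
  have := sqintD mD (sgf 0%N) (sf 0%N).
  by rewrite (_ : (fun x => _) = g)//; apply/funext => x; rewrite subrK.
move=> e e0.
have [m hm] : exists m, forall n, (m <= n)%N -> 8 * K * 4^-1 ^+ n <= e.
  by apply: geometric_small => //; rewrite mulr_ge0.
exists m => n mn; apply: le_trans (hm _ mn).
rewrite -lee_fin (le_trans _ (sqS n))// /dotI /Rintegral fineK.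
  by under eq_integral do rewrite -expr2.
exact: integrable_fin_num (sgf n).2.
Qed.
End completeness.

(** * Lebesgue measure and the topology of row vectors *)

Section rV_measure.
Context {R : realType}.
Local Notation leb := (@lebesgue_rV R _).

Definition cube n (M : R) := [set x : 'rV[R]_n | forall i, x ord0 i \in `[- M, M]].

Lemma measurable_coords n (B : 'I_n -> set R) : (forall i, measurable (B i)) ->
  measurable [set x : 'rV[R]_n | forall i, B i (x ord0 i)].
Proof.
move=> mB; rewrite (_ : [set x | _] = \bigcap_(i in setT)
  ((fun x : 'rV[R]_n => x ord0 i) @^-1` B i)).
  apply: fin_bigcap_measurable => // i _.
  by rewrite -[X in measurable X]setTI; exact: measurable_coord.
by apply/seteqP; split=> x /= h i; [move=> _|]; exact: h.
Qed.

Lemma bounded_sub_cube n (U : set 'rV[R]_n) : bounded_set U -> exists M, U `<=` cube M.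
Proof.
move=> [M [_ hM]]; exists (M + 1) => x Ux i.
have := hM (M + 1) ltac:(by rewrite ltrDl) x Ux.
rewrite in_itv /= -ler_norml; apply: le_trans; rewrite [leRHS]/Num.norm /= mx_normrE.
exact: (le_bigmax _ (fun ij => `|x ij.1 ij.2|) (ord0, i)).
Qed.

Lemma measurable_cube n M : measurable (@cube n M).
Proof. by apply: (@measurable_coords _ (fun=> `[- M, M]%classic)) => i; exact: measurable_itv. Qed.

Lemma measurable_box n (a b : 'I_n -> R) :
  measurable [set x : 'rV[R]_n | forall i, a i < x ord0 i < b i].
Proof.
have := @measurable_coords n (fun i => `]a i, b i[%classic) (fun i => measurable_itv _).
by congr measurable; apply/seteqP; split=> x /= h i; have := h i; rewrite in_itv.
Qed.

(** The sigma-algebra is generated by coordinates, not by the topology. An open set is the union of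
    the countably many rational boxes that it contains. *)
Lemma open_measurable_rV n (U : set 'rV[R]_n) : open U -> measurable U.
Proof.
move=> oU; pose box (q : {ffun 'I_n -> rat * rat}) :=
  [set x : 'rV[R]_n | forall i, ratr (q i).1 < x ord0 i < ratr (q i).2].
rewrite (_ : U = \bigcup_q (if `[<box q `<=` U>] then box q else set0)).
  apply: countable_bigcupT_measurable => [|q]; first exact: countableP.
  by case: ifP => _ //; exact: measurable_box.
apply/seteqP; split=> [x Ux|x [q _]]; last by case: ifPn => // /asboolP; exact.
have /nbhs_ballP[e /= e0 xeU] : nbhs x U by apply: open_nbhs_nbhs.
have /choice[a ha] : forall i, exists q : rat, x ord0 i - e < ratr q < x ord0 i.
  move=> i; have [q] := @rat_in_itvoo R (x ord0 i - e) (x ord0 i) ltac:(by rewrite ltrBlDr ltrDl).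
  by rewrite in_itv/= => ?; exists q.
have /choice[b hb] : forall i, exists q : rat, x ord0 i < ratr q < x ord0 i + e.
  move=> i; have [q] := @rat_in_itvoo R (x ord0 i) (x ord0 i + e) ltac:(by rewrite ltrDl).
  by rewrite in_itv/= => ?; exists q.
exists [ffun i => (a i, b i)] => //; rewrite ifT.
  move=> i; rewrite ffunE /=.
  by have /andP[_ ->] := ha i; have /andP[-> _] := hb i.
apply/asboolP => y yq; apply: xeU; split => // i j.
have := yq j; rewrite ffunE /= (ord1 i) => /andP[ay yb].
have /andP[a1 a2] := ha j; have /andP[b1 b2] := hb j.
by rewrite /ball /= ltr_norml; apply/andP; split; lra.
Qed.

Lemma lebesgue_rV_cube n (M : R) : (leb (@cube n M) < +oo)%E.
Proof.
elim: n => [|n ih].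
  rewrite (_ : cube M = setT); last by apply/seteqP; split => // x _ [].
  by rewrite /= diracT ltry.
rewrite /= /cons_measure /pushforward.
rewrite (_ : _ @^-1` _ = `[- M, M] `*` @cube n M).
  rewrite product_measure1E//=; last exact: measurable_cube.
  rewrite lebesgue_measure_itv/=.
  case: ifP => lM; last by rewrite mul0e.
  by rewrite -EFinB lte_mul_pinfty// lee_fin; move: lM; rewrite lte_fin; lra.
apply/seteqP; split => [[a x] /= h|[a x] /= [h1 h2]].
  split=> [|i].
    have := h ord0; rewrite /rVcons.
    have -> : ord0 = lshift n (ord0 : 'I_1) :> 'I_(1 + n) by exact/val_inj.
    by rewrite (row_mxEl (a%:M : 'rV[R]_1) x) mxE eqxx.
  by have := h (rshift 1 i); rewrite /rVcons (row_mxEr (a%:M : 'rV[R]_1) x).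
move=> i; rewrite /rVcons; case: (@split_ordP 1 n i) => j ->.
  by rewrite (row_mxEl (a%:M : 'rV[R]_1) x) (ord1 j) mxE eqxx.
by rewrite (row_mxEr (a%:M : 'rV[R]_1) x).
Qed.

Lemma bounded_lebesgue_rV n (U : set 'rV[R]_n) : bounded_set U -> measurable U ->
  (leb U < +oo)%E.
Proof.
move=> /bounded_sub_cube[M UM] mU; apply: le_lt_trans (lebesgue_rV_cube n M).
by apply: le_measure; rewrite ?inE//; exact: measurable_cube.
Qed.

Lemma continuous_measurable_rV n (D : set 'rV[R]_n) (f : 'rV[R]_n -> R) :
  measurable D -> continuous f -> measurable_fun D f.
Proof.
move=> mD /continuousP cf; apply: (measurability _ (RGenOpens.measurableE R)).
move=> _ [_ [a [b ->] <-]]; apply: measurableI => //; apply: open_measurable_rV.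
exact/cf/interval_open.
Qed.

Lemma continuous_bounded_rV n (D : set 'rV[R]_n) (f : 'rV[R]_n -> R) :
  bounded_set D -> continuous f -> exists K, forall x, D x -> `|f x| <= K.
Proof.
move=> /bounded_sub_cube[M DM] cf.
have : bounded_set (f @` cube M).
  apply: compact_bounded; apply: continuous_compact; first exact: continuous_subspaceT.
  by apply: (@rV_compact _ _ (fun=> `[- M, M]%classic)) => _; exact: segment_compact.
move=> [K [_ hK]]; exists (K + 1) => x Dx; apply: (hK (K + 1)); first by rewrite ltrDl.
by exists x => //; exact: DM.
Qed.

End rV_measure.

(** * The Sobolev space as a real Hilbert space *)

Section complex_parts.
Context {R : rcfType}.
Implicit Types (x y : R[i]) (a : R).

Lemma ReD x y : complex.Re (x + y) = complex.Re x + complex.Re y.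
Proof. by case: x y => [? ?] [? ?]. Qed.
Lemma ImD x y : complex.Im (x + y) = complex.Im x + complex.Im y.
Proof. by case: x y => [? ?] [? ?]. Qed.
Lemma ReZ a x : complex.Re ((a%:C)%C * x) = a * complex.Re x.
Proof. by case: x => u v /=; rewrite mul0r subr0. Qed.
Lemma ImZ a x : complex.Im ((a%:C)%C * x) = a * complex.Im x.
Proof. by case: x => u v /=; rewrite mul0r addr0. Qed.
Lemma Re_mulconj x y : complex.Re (x * y^*%C) =
  complex.Re x * complex.Re y + complex.Im x * complex.Im y.
Proof. by case: x y => [? ?] [? ?] /=; rewrite mulrN opprK. Qed.
Lemma sqr_normc x : Normc.normc x ^+ 2 = complex.Re x ^+ 2 + complex.Im x ^+ 2.
Proof. by case: x => u v /=; rewrite sqr_sqrtr// addr_ge0 ?sqr_ge0. Qed.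

End complex_parts.

Section jet_lmodule.
Context {R : realType} {d : nat}.
Local Notation jet := (@jet R d).

HB.instance Definition _ := gen_eqMixin jet.
HB.instance Definition _ := gen_choiceMixin jet.

Lemma jet_eqP (w z : jet) : (forall x, w.1 x = z.1 x) -> (forall x, w.2 x = z.2 x) -> w = z.
Proof.
by case: w z => [v g] [v' g'] /= hv hg; congr (_, _); apply/funext.
Qed.

Fact jaddA : associative (@jadd R d).
Proof. by move=> w z t; apply: jet_eqP => x /=; rewrite addrA. Qed.
Fact jaddC : commutative (@jadd R d).
Proof. by move=> w z; apply: jet_eqP => x /=; rewrite addrC. Qed.
Fact jadd0 : left_id (@jzero R d) (@jadd R d).
Proof. by move=> w; apply: jet_eqP => x /=; rewrite add0r. Qed.
Fact jaddN : left_inverse (@jzero R d) (jscale (-1)) (@jadd R d).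
Proof.
by move=> w; apply: jet_eqP => x /=; rewrite ?mulN1r ?scaleN1r addNr.
Qed.
HB.instance Definition _ := GRing.isZmodule.Build jet jaddA jaddC jadd0 jaddN.

Definition rscale (a : R) (w : jet) : jet := jscale (a%:C)%C w.
Fact rscaleA a b w : rscale a (rscale b w) = rscale (a * b) w.
Proof. by apply: jet_eqP => x /=; rewrite rmorphM/= ?mulrA ?scalerA. Qed.
Fact rscale1 : left_id 1 rscale.
Proof. by move=> w; apply: jet_eqP => x /=; rewrite ?mul1r ?scale1r. Qed.
Fact rscaleDr : right_distributive rscale +%R.
Proof. by move=> a w z; apply: jet_eqP => x /=; rewrite ?mulrDr ?scalerDr. Qed.
Fact rscaleDl w : {morph rscale^~ w : a b / a + b}.
Proof. by move=> a b; apply: jet_eqP => x /=; rewrite rmorphD/= ?mulrDl ?scalerDl. Qed.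
HB.instance Definition _ := GRing.Zmodule_isLmodule.Build R jet rscaleA rscale1 rscaleDr rscaleDl.

(** Indexing the real and imaginary parts of the value and of the gradient by one finite type
    reduces $H^1$ to a finite family of real $L^2$ functions. *)
Definition cpt (w : jet) (j : bool * option 'I_d) (x : 'rV[R]_d) : R :=
  let z := if j.2 is Some i then w.2 x ord0 i else w.1 x in
  if j.1 then complex.Im z else complex.Re z.

Lemma cptD w z j x : cpt (w + z) j x = cpt w j x + cpt z j x.
Proof.
by case: j => -[] [i|]; rewrite /cpt /= ?mxE ?ReD ?ImD.
Qed.

Lemma cptZ a w j x : cpt (a *: w) j x = a * cpt w j x.
Proof.
by case: j => -[] [i|]; rewrite /cpt /= ?mxE ?ReZ ?ImZ.
Qed.

Lemma cptB w z j x : cpt (w - z) j x = cpt w j x - cpt z j x.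
Proof. by rewrite -scaleN1r cptD cptZ mulN1r. Qed.

Lemma cpt0 j x : cpt 0 j x = 0.
Proof. by case: j => -[] [i|]; rewrite /cpt /= ?mxE. Qed.

End jet_lmodule.

(** * The weighted Sobolev inner product and its completeness *)

Section H1_space.
Context {R : realType} {d : nat}.
Local Notation jet := (@jet R d).
Local Notation leb := (@lebesgue_rV R d).
Variable Omega : set 'rV[R]_d.
Hypotheses (oOmega : open Omega) (bOmega : bounded_set Omega).
Local Notation H1 := (H1 Omega).
Local Notation sq := (sqint leb Omega).
Local Notation dot := (dotI leb Omega).

Let mOmega : measurable Omega. Proof. exact: open_measurable_rV. Qed.
Let finOmega : (leb Omega < +oo)%E. Proof. exact: bounded_lebesgue_rV. Qed.

Lemma L2P (v : 'rV[R]_d -> R[i]) :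
  L2 Omega v <-> sq (fun x => complex.Re (v x)) /\ sq (fun x => complex.Im (v x)).
Proof.
split=> [[[mr mi] vfin]|[[mr ri] [mi ii]]].
  have m2 : measurable_fun Omega (fun x => Normc.normc (v x) ^+ 2).
    rewrite (_ : (fun x => _) = (fun x => complex.Re (v x) ^+ 2 + complex.Im (v x) ^+ 2)).
      by apply: measurable_funD; exact: measurable_funX.
    by apply/funext => x; rewrite sqr_normc.
  have i2 : leb.-integrable Omega (EFin \o (fun x => Normc.normc (v x) ^+ 2)).
    apply/integrableP; split; first exact/measurable_EFinP.
    by under eq_integral do rewrite gee0_abs ?lee_fin ?sqr_ge0//.
  split; split => //; apply: le_integrableR i2 => //; try exact: measurable_funX;
    by move=> x _; rewrite sqr_normc ger0_norm ?sqr_ge0// ?lerDl ?lerDr ?sqr_ge0.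
split; first by split.
have /integrableP[_] := integrableDR mOmega ri ii; apply: le_lt_trans.
rewrite le_eqVlt; apply/orP; left; apply/eqP/eq_integral => x _ /=.
by rewrite sqr_normc ger0_norm// addr_ge0 ?sqr_ge0.
Qed.

(** Continuous functions are bounded on the bounded set [Omega], so both sides of the weak gradient
    identity are continuous functionals on $L^2$. *)
Lemma test_function_bounded (phi : 'rV[R]_d -> R) : smooth phi ->
  (sq phi) * (forall i, sq (partial i phi)).
Proof.
move=> sphi.
have key (psi : 'rV[R]_d -> R) : (forall x, differentiable psi x) -> sq psi.
  move=> dpsi; have cpsi : continuous psi by move=> x; exact: differentiable_continuous.
  have [K hK] := continuous_bounded_rV bOmega cpsi.
  by apply: (sqint_bounded mOmega finOmega _ hK); exact: continuous_measurable_rV.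
split=> [|i]; apply: key => x; first exact: (sphi [::]).
exact: (sphi [:: i]).
Qed.

Definition real_weak_gradient (w : jet) := forall phi, test_function Omega phi ->
  forall i b, dot (cpt w (b, None)) (partial i phi) = - dot (cpt w (b, Some i)) phi.

Lemma weak_gradientP w : weak_gradient Omega w.1 w.2 <-> real_weak_gradient w.
Proof.
have R1 (z : R[i]) (a : R) : complex.Re (z * (a%:C)%C) = complex.Re z * a.
  by rewrite mulrC ReZ mulrC.
have I1 (z : R[i]) (a : R) : complex.Im (z * (a%:C)%C) = complex.Im z * a.
  by rewrite mulrC ImZ mulrC.
split=> hw phi tphi i.
  have := hw phi tphi i; rewrite /cintegral => -[hr hi].
  have {}hr : dot (cpt w (false, None)) (partial i phi) = - dot (cpt w (false, Some i)) phi.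
    transitivity (\int[leb]_(x in Omega) complex.Re (w.1 x * ((partial i phi x)%:C)%C)).
      by apply: eq_Rintegral => x _; rewrite R1.
    by rewrite hr; congr (- _); apply: eq_Rintegral => x _; rewrite R1.
  have {}hi : dot (cpt w (true, None)) (partial i phi) = - dot (cpt w (true, Some i)) phi.
    transitivity (\int[leb]_(x in Omega) complex.Im (w.1 x * ((partial i phi x)%:C)%C)).
      by apply: eq_Rintegral => x _; rewrite I1.
    by rewrite hi; congr (- _); apply: eq_Rintegral => x _; rewrite I1.
  by case.
have hr := hw phi tphi i false; have hi := hw phi tphi i true.
rewrite /cintegral; congr Complex.
  transitivity (dot (cpt w (false, None)) (partial i phi)).
    by apply: eq_Rintegral => x _; rewrite R1.
  by rewrite hr; congr (- _); apply: eq_Rintegral => x _; rewrite R1.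
transitivity (dot (cpt w (true, None)) (partial i phi)).
  by apply: eq_Rintegral => x _; rewrite I1.
by rewrite hi; congr (- _); apply: eq_Rintegral => x _; rewrite I1.
Qed.

Lemma H1P w : H1 w <-> (forall j, sq (cpt w j)) /\ real_weak_gradient w.
Proof.
split=> [[/L2P[vr vi] gw /weak_gradientP ww]|[sw /weak_gradientP ww]].
  by split => // -[[] [i|]] //; have /L2P[] := gw i.
split => //; first by apply/L2P; split; [exact: (sw (false, None))|exact: (sw (true, None))].
by move=> i; apply/L2P; split; [exact: (sw (false, Some i))|exact: (sw (true, Some i))].
Qed.

Lemma sq_cpt w j : H1 w -> sq (cpt w j). Proof. by move=> /H1P[]. Qed.

Lemma H1_lin_closed : lin_closed H1.
Proof.
split.
  have c0 j : cpt (0 : jet) j = fun=> 0 by apply/funext => x; rewrite cpt0.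
  apply/H1P; split => [j|phi _ i b]; first by rewrite (c0 j); exact: sqint0.
  rewrite (c0 (b, None)) (c0 (b, Some i)).
  have z psi : dot (fun=> 0) psi = 0.
    by rewrite /dotI; under eq_Rintegral do rewrite mul0r; rewrite Rintegral_cst// mul0r.
  by rewrite !z oppr0.
move=> a w z /H1P[sw gw] /H1P[sz gz]; apply/H1P.
have cE j : cpt (a *: w + z) j = (fun x => a * cpt w j x + cpt z j x).
  by apply/funext => x; rewrite cptD cptZ.
split=> [j|phi tphi i b]; rewrite !cE.
  by apply: sqintD => //; exact: sqintZ.
have [sphi _ _] := tphi; have [s1 s2] := test_function_bounded sphi.
have fD j psi : sq psi -> dot (fun x => a * cpt w j x + cpt z j x) psi =
    a * dot (cpt w j) psi + dot (cpt z j) psi.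
  by move=> spsi; exact: (dotI_semi_inner leb mOmega).1.2 _ _ _ _ (sw j) (sz j) spsi.
by rewrite !fD// gw// gz// mulrN opprD.
Qed.

Variable kappa : R.
Hypothesis kappa0 : 0 < kappa.

Definition wt (j : bool * option 'I_d) : R := if j.2 is None then kappa ^+ 2 else 1.

Lemma wt_gt0 j : 0 < wt j.
Proof. by case: j => b [i|]; rewrite /wt //= exprn_gt0. Qed.

Definition H1form (w z : jet) : R := \sum_j wt j * dot (cpt w j) (cpt z j).

Lemma H1form_semi_inner : semi_inner H1 H1form.
Proof.
have [[dC dL] d0] := dotI_semi_inner leb mOmega.
split; first split.
- move=> w z hw hz; apply: eq_bigr => j _; congr (_ * _); apply: dC; exact: sq_cpt.
- move=> a w z t hw hz ht; rewrite /H1form mulr_sumr -big_split /=; apply: eq_bigr => j _.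
  rewrite (_ : cpt (a *: w + z) j = a *: (cpt w j : _ -> R^o) + cpt z j).
    by rewrite (dL a _ _ _ (sq_cpt j hw) (sq_cpt j hz) (sq_cpt j ht)) mulrDr mulrCA.
  by apply/funext => x; rewrite cptD cptZ.
- move=> w hw; apply: sumr_ge0 => j _; rewrite mulr_ge0 ?(ltW (wt_gt0 _))// d0//.
  exact: sq_cpt.
Qed.

Lemma sum_cpt (F : bool * option 'I_d -> R) :
  \sum_j F j = \sum_i (F (false, Some i) + F (true, Some i)) + (F (false, None) + F (true, None)).
Proof.
rewrite (eq_bigr (fun j => F (j.1, j.2))) => [|[]//].
rewrite -(pair_bigA _ (fun b o => F (b, o))) big_bool /=.
have opt b : \sum_o F (b, o) = F (b, None) + \sum_i F (b, Some i).
  rewrite (bigD1 None)//=; congr (_ + _).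
  rewrite (reindex_omap Some id)/=; last by case.
  by apply: eq_bigl => i; rewrite eqxx.
by rewrite !opt big_split /=; ring.
Qed.

Lemma H1k_normE w : H1 w -> H1k_norm Omega kappa w = fnorm H1form w.
Proof.
move=> hw; rewrite /H1k_norm /fnorm /H1form sum_cpt /=; congr Num.sqrt.
have c2 j : leb.-integrable Omega (EFin \o (fun x => cpt w j x * cpt w j x)).
  by apply: sqintM => //; exact: sq_cpt.
congr (_ + _).
  transitivity (\int[leb]_(x in Omega) \sum_i
      (cpt w (false, Some i) x * cpt w (false, Some i) x +
       cpt w (true, Some i) x * cpt w (true, Some i) x)).
    by apply: eq_Rintegral => x _; apply: eq_bigr => i _; rewrite sqr_normc -!expr2.
  rewrite (Rintegral_sum mOmega _ _).2; last by move=> i; exact: integrableDR.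
  by apply: eq_bigr => i _; rewrite RintegralD// /wt /= !mul1r.
rewrite /wt /= -mulrDr -RintegralD//; congr (_ * _).
by apply: eq_Rintegral => x _; rewrite sqr_normc -!expr2.
Qed.

Lemma H1_eqP w z : H1_eq Omega w z <->
  {ae leb, forall x, Omega x -> forall j, cpt w j x = cpt z j x}.
Proof.
split; apply: filterS => x h Ox; have {}h := h Ox.
  by case: h => h1 h2 [b [i|]]; rewrite /cpt /= ?h1 ?h2.
split.
  have := h (false, None); have := h (true, None); rewrite /cpt /=.
  by case: (w.1 x) (z.1 x) => [? ?] [? ?] /= -> ->.
apply/rowP => i; have := h (false, Some i); have := h (true, Some i); rewrite /cpt /=.
by case: (w.2 x ord0 i) (z.2 x ord0 i) => [? ?] [? ?] /= -> ->.
Qed.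

Lemma sq_dot_eq0 f : sq f -> dot f f = 0 <-> {ae leb, forall x, Omega x -> f x = 0}.
Proof.
move=> sf; have ff : leb.-integrable Omega (EFin \o (fun x => f x * f x)) by exact: sqintM.
have mff : measurable_fun Omega (EFin \o (fun x => f x * f x)) by have /integrableP[] := ff.
have key := ae_eq_integral_abs leb mOmega mff.
have absE : (\int[leb]_(x in Omega) `|(EFin \o (fun x => (f x * f x)%R)) x|)%E = (dot f f)%:E.
  rewrite /dotI /Rintegral fineK; last exact: integrable_fin_num ff.
  by apply: eq_integral => x _; rewrite gee0_abs// lee_fin -expr2 sqr_ge0.
rewrite absE in key; split=> [h|h].
  have /key : (dot f f)%:E = 0%E by rewrite h.
  by apply: filterS => x fx Ox; have := fx Ox => -[] /eqP; rewrite mulf_eq0 orbb => /eqP.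
apply: EFin_inj; apply: key.2; apply: filterS h => x fx Ox /=.
by rewrite fx// mul0r.
Qed.

Lemma H1form_eq0 w : H1 w -> (H1form w w = 0 <-> H1_eq Omega w 0).
Proof.
move=> hw; split=> [h|/H1_eqP h].
  apply/H1_eqP.
  have aej j : {ae leb, forall x, Omega x -> cpt w j x = 0}.
    apply/(sq_dot_eq0 (sq_cpt j hw)).
    have [_ dot0] := dotI_semi_inner leb mOmega.
    have /psumr_eq0P/(_ h j isT)/eqP : forall k, true -> 0 <= wt k * dot (cpt w k) (cpt w k).
      by move=> k _; rewrite mulr_ge0 ?(ltW (wt_gt0 _))// dot0//; exact: sq_cpt.
    by rewrite mulf_eq0 gt_eqF ?wt_gt0//= => /eqP.
  have : {ae leb, forall x j, Omega x -> cpt w j x = 0} by apply: filter_forall.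
  apply: filterS => x hx Ox j.
  by rewrite hx// cpt0.
apply: big1 => j _; rewrite (_ : dot _ _ = 0) ?mulr0//.
apply/(sq_dot_eq0 (sq_cpt j hw)); apply: filterS h => x hx Ox.
by rewrite hx// cpt0.
Qed.

Lemma dot_cpt_le w j : H1 w -> dot (cpt w j) (cpt w j) <= (wt j)^-1 * H1form w w.
Proof.
move=> hw; rewrite ler_pdivlMl ?wt_gt0// /H1form (bigD1 j)//= lerDl sumr_ge0// => k _.
have [_ dot0] := dotI_semi_inner leb mOmega.
by rewrite mulr_ge0 ?(ltW (wt_gt0 _))// dot0//; exact: sq_cpt.
Qed.

(** Each component converges in $L^2$, and the limits are assembled into one jet. Its second half is
    a weak gradient of the first because the defining identity is a pairing with fixed $L^2$
    functions and passes to the limit. *)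
Lemma H1_geom_complete : geom_complete H1 H1form.
Proof.
move=> x hx dx; have hH1 := H1_lin_closed.
have hd n : H1 (x n.+1 - x n) by exact: lin_closedB.
have /choice[g hg] : forall j, exists g, sq g /\ forall e, 0 < e ->
    exists m, forall n, (m <= n)%N ->
    dot (fun t => g t - cpt (x n) j t) (fun t => g t - cpt (x n) j t) <= e.
  move=> j.
  have [||g sg lg] := @sqint_complete _ _ _ leb Omega mOmega (wt j)^-1 (fun n => cpt (x n) j).
  - by move=> n; exact: sq_cpt.
  - move=> n; have -> : (fun t => cpt (x n.+1) j t - cpt (x n) j t) = cpt (x n.+1 - x n) j.
      by apply/funext => t; rewrite cptB.
    apply: (le_trans (dot_cpt_le j (hd n))); rewrite ler_wpM2l ?invr_ge0 ?(ltW (wt_gt0 _))//.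
    rewrite -(sqr_fnorm H1form_semi_inner (hd n)).
    apply: (@le_trans _ _ ((3^-1 ^+ n.+1) ^+ 2)).
      by rewrite ler_pXn2r ?nnegrE ?fnorm_ge0 ?exprn_ge0 ?invr_ge0//; exact: dx.
    rewrite -exprM mulnC exprM exprS.
    have -> : 3^-1 ^+ 2 = 9^-1 :> R by field.
    by rewrite ler_piMl ?exprn_ge0 ?invr_ge0// invf_le1// ler1n.
  by exists g.
pose y : jet := (fun t => Complex (g (false, None) t) (g (true, None) t),
  fun t => \row_i Complex (g (false, Some i) t) (g (true, Some i) t)).
have cy j : cpt y j = g j by apply/funext => t; case: j => [[] [i|]]; rewrite /cpt /= ?mxE.
have sg j : sq (g j) by have [] := hg j.
have lim_dot j psi e : sq psi -> 0 < e -> exists m, forall n, (m <= n)%N ->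
    `|dot (g j) psi - dot (cpt (x n) j) psi| <= e.
  (* The tolerance is adapted to Cauchy-Schwarz; the added 1 keeps the denominator positive when
     [psi] is null. *)
  move=> spsi e0; have [_ /(_ (e ^+ 2 / (dot psi psi + 1)))] := hg j.
  have psi0 : 0 <= dot psi psi by apply: (dotI_semi_inner leb mOmega).2.
  case=> [|m hm]; first by rewrite divr_gt0 ?exprn_gt0// ltr_wpDl.
  exists m => n mn; have sgn : sq (fun t => g j t - cpt (x n) j t).
    by apply: sqintB => //; exact: sq_cpt.
  rewrite (_ : _ - _ = dot (fun t => g j t - cpt (x n) j t) psi); last first.
    rewrite /dotI -RintegralB//; [|exact: sqintM|by apply: sqintM => //; exact: sq_cpt].
    by apply: eq_Rintegral => t _; rewrite mulrBl.
  rewrite -(@ler_pXn2r _ 2) ?nnegrE ?(ltW e0)// real_normK ?num_real//.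
  apply: (le_trans (dotI_cauchy_schwarz mOmega sgn spsi)).
  apply: (le_trans (ler_wpM2r psi0 (hm _ mn))).
  rewrite mulrAC ler_pdivrMr ?ltr_wpDl// ler_wpM2l ?sqr_ge0// lerDl//.
have hy : H1 y.
  apply/H1P; split=> [j|phi tphi i b]; first by rewrite cy.
  rewrite !cy; apply/eqP; rewrite -subr_eq0 opprK -normr_le0.
  have [sphi _ _] := tphi; have [s1 s2] := test_function_bounded sphi.
  apply/ler_addgt0Pr => e e0; rewrite add0r.
  have e2 : 0 < e / 2 by rewrite divr_gt0.
  have [m hm] := lim_dot (b, None) _ _ (s2 i) e2.
  have [m' hm'] := lim_dot (b, Some i) _ _ s1 e2.
  have h := hm _ (leq_maxl m m'); have h' := hm' _ (leq_maxr m m').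
  have /H1P[_ /(_ _ tphi i b) wg] := hx (maxn m m').
  move: h h'; set X := dot (g _) _; set Y := dot (g _) _.
  rewrite wg opprK; set Z := dot (cpt _ _) _ => h h'.
  have := ler_normD (X + Z) (Y - Z).
  by rewrite addrACA subrr addr0; lra.
exists y => // e e0.
pose K := \sum_j wt j + 1.
have K0 : 0 < K by rewrite ltr_wpDl// sumr_ge0// => j _; exact/ltW/wt_gt0.
have /choice[m hm] : forall j, exists m, forall n, (m <= n)%N ->
    dot (fun t => g j t - cpt (x n) j t) (fun t => g j t - cpt (x n) j t) <= e ^+ 2 / K.
  by move=> j; have [_] := hg j; apply; rewrite divr_gt0 ?exprn_gt0.
exists (\max_j m j) => n mn.
rewrite -(@ler_pXn2r _ 2) ?nnegrE ?(ltW e0) ?fnorm_ge0//.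
rewrite (sqr_fnorm H1form_semi_inner); last exact: lin_closedB.
apply: (@le_trans _ _ (\sum_j wt j * (e ^+ 2 / K))).
  apply: ler_sum => j _; rewrite ler_wpM2l ?(ltW (wt_gt0 _))//.
  have -> : cpt (y - x n) j = (fun t => g j t - cpt (x n) j t).
    by apply/funext => t; rewrite cptB cy.
  by apply: hm; apply: leq_trans mn; exact: leq_bigmax.
rewrite -mulr_suml mulrC mulrAC ler_pdivrMr// ler_wpM2l ?sqr_ge0//.
by rewrite /K lerDl.
Qed.

End H1_space.

(** * The energy and its second variation *)

Section ginzburg_landau_theory.
Context {R : realType} {d : nat}.
Local Notation jet := (@jet R d).
Local Notation leb := (@lebesgue_rV R d).
Variables (Omega : set 'rV[R]_d) (A : 'rV[R]_d -> 'rV[R]_d) (kappa : R).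
Hypotheses (oOmega : open Omega) (bOmega : bounded_set Omega).
Hypotheses (hA : Linfty_field Omega A) (kappa0 : 0 < kappa).
Local Notation H1 := (H1 Omega).
Local Notation sq := (sqint leb Omega).
Implicit Types (u v w z : jet) (x : 'rV[R]_d).

Let mOmega : measurable Omega. Proof. exact: open_measurable_rV. Qed.
Let finOmega : (leb Omega < +oo)%E. Proof. exact: bounded_lebesgue_rV. Qed.
Let hH1 : lin_closed H1. Proof. exact: H1_lin_closed. Qed.

Definition mcp w (j : bool * 'I_d) x : R :=
  if j.1 then cpt w (true, Some j.2) x + kappa * (A x ord0 j.2 * cpt w (false, None) x)
  else cpt w (false, Some j.2) x - kappa * (A x ord0 j.2 * cpt w (true, None) x).

Lemma mcpE w x i : mcp w (false, i) x = complex.Re (mgrad A kappa w x ord0 i) /\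
  mcp w (true, i) x = complex.Im (mgrad A kappa w x ord0 i).
Proof.
rewrite /mcp /mgrad /cpt /= !mxE.
by case: (w.2 x ord0 i) (w.1 x) => [a b] [p q] /=; split; ring.
Qed.

Lemma mcpD w z j x : mcp (w + z) j x = mcp w j x + mcp z j x.
Proof. by rewrite /mcp !cptD; case: ifP => _; ring. Qed.

Lemma mcpZ a w j x : mcp (a *: w) j x = a * mcp w j x.
Proof. by rewrite /mcp !cptZ; case: ifP => _; ring. Qed.

Lemma sq_mcp w j : H1 w -> sq (mcp w j).
Proof.
move=> hw; have [mA Afin] := hA.
have Abd i : {ae leb, forall x, Omega x -> `|A x ord0 i| <= fine (ess_supA Omega A)}.
  have := ess_sup_ge leb ((fun x => (enorm (A x))%:E) \_ Omega).
  rewrite -/(ess_supA Omega A); apply: filterS => x + Ox.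
  rewrite patchE mem_set//; move: Afin; case: (ess_supA Omega A) => // r _.
  rewrite lee_fin /=; apply: le_trans; rewrite /enorm /dotr -sqrtr_sqr ler_wsqrtr//.
  by rewrite (bigD1 i)//= -expr2 lerDl sumr_ge0// => k _; rewrite -expr2 sqr_ge0.
have sA i k : sq (fun x => kappa * (A x ord0 i * cpt w k x)).
  by apply: sqintZ => //; apply: (sqint_ae_bounded mOmega (mA i) (Abd i)); exact: sq_cpt.
case: j => -[] i; rewrite /mcp /=; first by apply: sqintD => //; exact: sq_cpt.
by apply: sqintB => //; exact: sq_cpt.
Qed.

Definition dotv u w x := cpt u (false, None) x * cpt w (false, None) x +
  cpt u (true, None) x * cpt w (true, None) x.

Lemma dotvC u w x : dotv u w x = dotv w u x.
Proof. by rewrite /dotv; congr (_ + _); rewrite mulrC. Qed.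

Lemma dotvDl u w z x : dotv (u + w) z x = dotv u z x + dotv w z x.
Proof. by rewrite /dotv !cptD; ring. Qed.

Lemma dotvZl a w z x : dotv (a *: w) z x = a * dotv w z x.
Proof. by rewrite /dotv !cptZ; ring. Qed.

Definition dens2 u w z x := \sum_j mcp w j x * mcp z j x +
  kappa ^+ 2 * ((dotv u u x - 1) * dotv w z x + 2 * (dotv u w x * dotv u z x)).

Lemma sum_mcp (F : bool * 'I_d -> R) : \sum_j F j = \sum_i (F (false, i) + F (true, i)).
Proof.
rewrite (eq_bigr (fun j => F (j.1, j.2))) => [|[]//].
by rewrite -(pair_bigA _ (fun b o => F (b, o))) big_bool /= big_split /= addrC.
Qed.

Lemma energy2E u w z : energy2 Omega A kappa u w z = \int[leb]_(x in Omega) dens2 u w z x.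
Proof.
apply: eq_Rintegral => x _; rewrite ReD; congr (_ + _).
  rewrite (big_morph _ (@ReD R) (erefl : complex.Re 0 = 0)) sum_mcp.
  apply: eq_bigr => i _; rewrite Re_mulconj.
  by have [-> ->] := mcpE w x i; have [-> ->] := mcpE z x i.
rewrite ReZ; congr (_ * _); rewrite sqr_normc /dotv /cpt /=.
by case: (u.1 x) (w.1 x) (z.1 x) => [? ?] [? ?] [? ?] /=; ring.
Qed.

Definition dens v x := \sum_j mcp v j x ^+ 2 + kappa ^+ 2 / 2 * (1 - dotv v v x) ^+ 2.

Lemma dens_ge0 v x : 0 <= dens v x.
Proof.
apply: addr_ge0; first by apply: sumr_ge0 => j _; exact: sqr_ge0.
by apply: mulr_ge0; [apply: divr_ge0|]; rewrite ?sqr_ge0.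
Qed.

Lemma energyE v : energy Omega A kappa v = ((2^-1)%:E * \int[leb]_(x in Omega) (dens v x)%:E)%E.
Proof.
congr (_ * _)%E; apply: eq_integral => x _; congr ((_ + _)%:E).
  rewrite sum_mcp; apply: eq_bigr => i _; rewrite sqr_normc.
  by have [-> ->] := mcpE v x i.
by rewrite sqr_normc /dotv /cpt /= -!expr2.
Qed.

(** Since [dotv v v] is $|v|^2$, this is membership in $L^4$, phrased so that the $L^2$ lemmas apply
    to quartic terms. *)
Definition L4 v := sq (dotv v v).

Lemma measurable_dotv u w : H1 u -> H1 w -> measurable_fun Omega (dotv u w).
Proof.
by move=> hu hw; apply: measurable_funD; apply: measurable_funM; exact: (sq_cpt _ _ _).1.
Qed.

Lemma sq_mul_cpt u w b c : H1 u -> H1 w -> L4 u -> L4 w ->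
  sq (fun x => cpt u (b, None) x * cpt w (c, None) x).
Proof.
move=> hu hw u4 w4; apply: (@sqint_le _ _ _ _ _ mOmega _ (fun x => dotv u u x + dotv w w x)).
- by apply: measurable_funM; exact: (sq_cpt _ _ _).1.
- move=> x _; have uu : cpt u (b, None) x ^+ 2 <= dotv u u x.
    by rewrite /dotv -!expr2; case: b; rewrite ?lerDl ?lerDr sqr_ge0.
  have ww : cpt w (c, None) x ^+ 2 <= dotv w w x.
    by rewrite /dotv -!expr2; case: c; rewrite ?lerDl ?lerDr sqr_ge0.
  rewrite [leRHS]ger0_norm; last by rewrite addr_ge0// (le_trans _ uu, le_trans _ ww) ?sqr_ge0.
  move: uu ww; set p := cpt u _ x; set q := cpt w _ x => uu ww.
  have := sqr_ge0 (p + q); have := sqr_ge0 (p - q).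
  by rewrite ler_norml => h1 h2; apply/andP; split; nra.
- exact: sqintD.
Qed.

Lemma sq_dotv u w : H1 u -> H1 w -> L4 u -> L4 w -> sq (dotv u w).
Proof. by move=> hu hw u4 w4; apply: sqintD => //; exact: sq_mul_cpt. Qed.

Lemma L4_lin (a : R) v w : H1 v -> H1 w -> L4 v -> L4 w -> L4 (a *: v + w).
Proof.
move=> hv hw v4 w4; rewrite /L4.
have -> : dotv (a *: v + w) (a *: v + w) =
    (fun x => a ^+ 2 * dotv v v x + (2 * a * dotv v w x + dotv w w x)).
  by apply/funext => x; rewrite /dotv !cptD !cptZ; ring.
apply: sqintD => //; first exact: sqintZ.
by apply: sqintD => //; apply: sqintZ => //; exact: sq_dotv.
Qed.

Lemma L4_0 : L4 0.
Proof.
rewrite /L4 (_ : dotv 0 0 = fun=> 0); first exact: sqint0.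
by apply/funext => x; rewrite /dotv !cpt0 mulr0 addr0.
Qed.

Let sq1 : sq (fun=> 1).
Proof. by apply: (@sqint_bounded _ _ _ _ _ mOmega 1) => // x _; rewrite normr1. Qed.

Lemma integrable_mcp v w : H1 v -> H1 w ->
  leb.-integrable Omega (EFin \o (fun x => \sum_j mcp v j x * mcp w j x)).
Proof.
move=> hv hw; apply: (Rintegral_sum mOmega _ (F := fun j x => mcp v j x * mcp w j x) _).1 => j.
by apply: sqintM => //; exact: sq_mcp.
Qed.

Lemma integrable_dens v : H1 v -> L4 v -> leb.-integrable Omega (EFin \o dens v).
Proof.
move=> hv v4; apply: integrableDR => //; first exact: integrable_mcp.
by apply: integrableZR => //; apply: (sqintB mOmega sq1 v4).2.
Qed.

(** The potential term makes $1-|v|^2$ square integrable, and constants are square integrable on a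
    bounded domain. *)
Lemma finite_energy_L4 v : H1 v -> (energy Omega A kappa v < +oo)%E -> L4 v.
Proof.
move=> hv; rewrite energyE => efin.
have md : measurable_fun Omega (dotv v v) by exact: measurable_dotv.
have m1 : measurable_fun Omega (fun x => 1 - dotv v v x) by exact: measurable_funB.
have dfin : (\int[leb]_(x in Omega) (dens v x)%:E < +oo)%E.
  move: efin; have : (0 <= \int[leb]_(x in Omega) (dens v x)%:E)%E.
    by apply: integral_ge0 => x _; rewrite lee_fin dens_ge0.
  by case: (integral _ _ _) => [r _ _|_|//]; [exact: ltry|rewrite gt0_muley// lte_fin].
have mdens : measurable_fun Omega (dens v).
  apply: measurable_funD; last by apply: measurable_funM => //; exact: measurable_funX.
  apply: measurable_sum => j; apply: measurable_funX; exact: (sq_mcp j hv).1.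
suff s1 : sq (fun x => 1 - dotv v v x).
  have := sqintB mOmega sq1 s1; congr (sqint _ _ _).
  by apply/funext => x; ring.
split => //; have k2 : 0 < kappa ^+ 2 / 2 by rewrite divr_gt0 ?exprn_gt0.
have : leb.-integrable Omega (EFin \o (fun x => (kappa ^+ 2 / 2)^-1 * dens v x)).
  apply: integrableZR => //; apply/integrableP; split; first exact/measurable_EFinP.
  by under eq_integral do rewrite gee0_abs ?lee_fin ?dens_ge0//.
apply: le_integrableR => //; first exact: measurable_funX.
move=> x _; rewrite ger0_norm ?sqr_ge0// ler_pdivlMl// lerDr sumr_ge0// => j _.
by rewrite sqr_ge0.
Qed.


Lemma sq_ae_eq f g : measurable_fun Omega f ->
  {ae leb, forall x, Omega x -> f x = g x} -> sq g -> sq f.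
Proof.
move=> mf fg [mg ig]; split => //; apply/integrableP; split.
  by apply/measurable_EFinP; exact: measurable_funX.
have /integrableP[_] := ig; apply: le_lt_trans.
apply: ae_ge0_le_integral => //.
- by apply: measurableT_comp => //; apply/measurable_EFinP; exact: measurable_funX.
- by apply: measurableT_comp => //; apply/measurable_EFinP; exact: measurable_funX.
- by apply: filterS fg => x h Ox; rewrite /= h.
Qed.

(** The competitor 0 has finite energy. *)
Lemma minimizer_L4 u : minimizer Omega A kappa u -> L4 u.
Proof.
move=> [hu umin]; apply: finite_energy_L4 => //.
have h0 : H1 0 := hH1.1.
apply: (le_lt_trans (umin _ h0)).
have d0 := L4_0.
have /(integrable_fin_num mOmega) := integrable_dens h0 d0.
rewrite energyE; case: (integral _ _ _) => // r _.
by rewrite -EFinM ltry.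
Qed.

End ginzburg_landau_theory.

(** * Derivatives of functions supported at one point *)

Section derivative_of_spike.
Context {R : realType}.

(* [lim] of a divergent filter is [0] in [R], so the derivative operator sends a
   function supported at one point to [0], whatever its value there. *)
Lemma derive1_spike (f : R -> R) : (forall t, t != 0 -> f t = 0) ->
  forall t, derive1 f t = 0.
Proof.
move=> f0 t; rewrite /derive1.
set q := fun h : R => _.
have lim0 : q @ 0^' --> (0 : R) -> lim (q @ 0^') = 0 by move=> /cvg_lim; exact.
have [t0|t0] := eqVneq t 0; last first.
  apply: lim0; apply: cvg_near_cst.
  have : \forall h \near (0 : R)^', `|h| < `|t|.
    by apply: dnbhs0_lt; rewrite normr_gt0.
  apply: filterS => h ht; rewrite /q !f0 ?subr0 ?scaler0//.
  by apply: contraTneq ht => /eqP; rewrite addr_eq0 => /eqP ->; rewrite normrN ltxx.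
subst t.
have qE : \forall h \near (0 : R)^', q h = h^-1 * - f 0.
  near=> h; rewrite /q addr0 f0 ?sub0r//; near: h; exact: nbhs_dnbhs_neq.
(* If the quotient converges, its product with [h] tends both to 0 and to [- f 0], so [f 0 = 0] and
   the quotient vanishes near 0. *)
have [/cvg_ex[l ql]|/dvgP//] := pselect (cvg (q @ 0^')).
have : (fun h => h * q h) @ 0^' --> (0 * l : R).
  by apply: cvgM => //; exact: cvg_within.
have : (fun h => h * q h) @ 0^' --> (- f 0 : R).
  apply: cvg_near_cst; near=> h.
  have -> : q h = h^-1 * - f 0 by near: h.
  by rewrite mulVKf//; near: h; exact: nbhs_dnbhs_neq.
move=> /cvg_unique /[apply]; rewrite mul0r => f00.
apply: lim0; apply: cvg_near_cst; apply: filterS qE => h ->.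
by rewrite f00// mulr0.
Unshelve. all: by end_near. Qed.

End derivative_of_spike.

(** * Lines through the minimizer and the sign of the second variation *)

Section second_variation.
Context {R : realType} {d : nat}.
Local Notation jet := (@jet R d).
Local Notation leb := (@lebesgue_rV R d).
Variables (Omega : set 'rV[R]_d) (A : 'rV[R]_d -> 'rV[R]_d) (kappa : R).
Hypotheses (oOmega : open Omega) (bOmega : bounded_set Omega).
Hypotheses (hA : Linfty_field Omega A) (kappa0 : 0 < kappa).
Local Notation H1 := (H1 Omega).
Local Notation sq := (sqint leb Omega).
Local Notation L4 := (L4 Omega).
Local Notation B := (energy2 Omega A kappa).
Implicit Types (u v w z : jet) (x : 'rV[R]_d).

Let mOmega : measurable Omega. Proof. exact: open_measurable_rV. Qed.
Let hH1 : lin_closed H1. Proof. exact: H1_lin_closed. Qed.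

(** The difference quotients of a line equal the derivative exactly for [s != t], so the quantity
    whose limit is taken is constantly 0. *)
Lemma smooth_curve_line u v : H1 u -> H1 v ->
  smooth_curve Omega (fun n t => if n is k.+1 then (if k is 0%N then v else 0) else u + t *: v).
Proof.
move=> hu hv.
set D := fun n t => _.
have hD n t : H1 (D n t).
  case: n => [|[|n]] //; last exact: hH1.1.
  by rewrite /D addrC; apply: hH1.2.
move=> n t _; split; first exact: hD.
apply: cvg_near_cst; rewrite /within /=.
have : \forall s \near t^', s != t by exact: nbhs_dnbhs_neq.
apply: filterS => s st _.
have st0 : s - t != 0 by rewrite subr_eq0.
rewrite (_ : jsub _ _ = 0).
  rewrite /H1_norm H1k_normE//; last exact: hH1.1.
  exact: (fnorm0 hH1 (H1form_semi_inner oOmega ltr01)).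
change ((s - t)^-1 *: (D n s - D n t) - D n.+1 t = 0).
case: n => [|n]; rewrite /D.
  by rewrite opprD addrACA subrr add0r -scalerBl scalerA mulVf// scale1r subrr.
by case: n => [|n]; rewrite !subrr ?scaler0 ?subr0.
Qed.

(* For [v] outside [L^4], the energy of [u + t v] is finite at [t = 0] only, so
   its second derivative is [0] by [derive1_spike] and local uniqueness makes
   [v] a multiple of [iu]. *)
Lemma locally_unique_L4 u : minimizer Omega A kappa u -> locally_unique Omega A kappa u ->
  forall v, H1 v -> L4 v.
Proof.
move=> umin uniq v hv; apply: contrapT => v4.
have hu : H1 u := umin.1.
have u4 : L4 u by exact: (minimizer_L4 oOmega bOmega hA kappa0).
pose D n t := if n is k.+1 then (if k is 0%N then v else 0) else u + t *: v.
have einf t : t != 0 -> fine (energy Omega A kappa (D 0%N t)) = 0.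
  move=> t0; have huv : H1 (u + t *: v) by rewrite addrC; exact: hH1.2.
  have [efin|] := pselect (energy Omega A kappa (u + t *: v)%R < +oo)%E; last first.
    by move=> /negP; rewrite ltey negbK => /eqP ->.
  (* Finite energy would put [u + t *: v] in $L^4$, and [v] is a linear combination of it and
     [u]. *)
  exfalso; apply: v4.
  have uv4 := finite_energy_L4 oOmega bOmega hA kappa0 huv efin.
  have hw : H1 (- t^-1 *: u + 0) by apply: hH1.2 => //; exact: hH1.1.
  have L40 : L4 0 by exact: L4_0.
  have w4 : L4 (- t^-1 *: u + 0) by apply: L4_lin => //; exact: hH1.1.
  have -> : v = t^-1 *: (u + t *: v) + (- t^-1 *: u + 0).
    by rewrite addr0 scalerDr scalerA mulVf// scale1r addrC addrA -scalerDl addNr scale0r add0r.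
  exact: L4_lin.
have D0u : H1_eq Omega (D 0%N 0) u.
  by rewrite /D scale0r addr0; apply: aeW.
have [] := uniq D (smooth_curve_line hu hv) D0u.
move=> /(_ _)[|alpha /H1_eqP valpha _].
  have spike : derive1 (fun t => fine (energy Omega A kappa (D 0%N t))) = cst 0.
    by apply/funext => t; rewrite derive1_spike.
  by rewrite /derive1n /= spike; apply: derive1_spike.
apply: v4; apply: (sq_ae_eq oOmega _ _ (sqintZ mOmega (alpha ^+ 2) u4)).
  exact: measurable_dotv.
apply: filterS valpha => x h Ox; have := h Ox (false, None); have := h Ox (true, None).
rewrite /dotv /cpt /=; case: (u.1 x) (v.1 x) => [a b] [p q] /= -> ->; ring.
Qed.

Section form.
Hypothesis H1L4 : forall v, H1 v -> L4 v.
Variable u : jet.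
Hypothesis umin : minimizer Omega A kappa u.

Let hu : H1 u. Proof. exact: umin.1. Qed.

Lemma integrable_dens2 v w : H1 v -> H1 w ->
  leb.-integrable Omega (EFin \o dens2 A kappa u v w).
Proof.
move=> hv hw; apply: integrableDR => //; first exact: integrable_mcp.
apply: integrableZR => //; apply: integrableDR => //.
  apply: sqintM => //; last by apply: sq_dotv => //; exact: H1L4.
  apply: sqintB => //; first exact: H1L4.
  apply: (@sqint_bounded _ _ _ _ _ mOmega 1) => //; first exact: bounded_lebesgue_rV.
  by move=> x _; rewrite normr1.
by apply: integrableZR => //; apply: sqintM => //; apply: sq_dotv => //; exact: H1L4.
Qed.

Lemma dens2_lin a v w z x : dens2 A kappa u (a *: v + w) z x =
  a * dens2 A kappa u v z x + dens2 A kappa u w z x.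
Proof.
rewrite /dens2 (dotvC u (_ + _)) !dotvDl !dotvZl -!(dotvC u).
rewrite (eq_bigr (fun j => a * (mcp A kappa v j x * mcp A kappa z j x) +
  mcp A kappa w j x * mcp A kappa z j x)); last first.
  by move=> j _; rewrite mcpD mcpZ; ring.
by rewrite big_split /= -mulr_sumr; ring.
Qed.

Lemma dens2_sym v w x : dens2 A kappa u v w x = dens2 A kappa u w v x.
Proof.
rewrite /dens2 (dotvC v w) [dotv u v x * _]mulrC; congr (_ + _).
by apply: eq_bigr => j _; rewrite mulrC.
Qed.

(** The density is a quartic polynomial in [t]. Odd powers cancel in the symmetric sum, leaving an
    exact identity without a Taylor remainder. *)
Lemma dens_second_difference v t x :
  dens A kappa (u + t *: v) x + dens A kappa (u + - t *: v) x =
  2 * dens A kappa u x + (2 * t ^+ 2 * dens2 A kappa u v v x +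
    kappa ^+ 2 * t ^+ 4 * (dotv v v x * dotv v v x)).
Proof.
have mE s : \sum_j mcp A kappa (u + s *: v) j x ^+ 2 =
    \sum_j mcp A kappa u j x ^+ 2 +
    2 * s * (\sum_j mcp A kappa u j x * mcp A kappa v j x)
    + s ^+ 2 * (\sum_j mcp A kappa v j x * mcp A kappa v j x).
  rewrite !mulr_sumr -!big_split /=; apply: eq_bigr => j _.
  by rewrite mcpD mcpZ; ring.
rewrite /dens /dens2 !mE.
have dE s : dotv (u + s *: v) (u + s *: v) x =
    dotv u u x + 2 * s * dotv u v x + s ^+ 2 * dotv v v x.
  by rewrite /dotv !cptD !cptZ; ring.
by rewrite !dE; field.
Qed.

(** For the sign, integrate the second difference: minimality at [u + t v] and [u - t v] gives
    $2t^2b+\kappa^2t^4q\ge0$ for every [t], where $b$ is the second variation and $q$ the integral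
    of $|v|^4$. *)
Lemma energy2_semi_inner : semi_inner H1 (B u).
Proof.
split; first split.
- by move=> v w hv hw; rewrite !energy2E; apply: eq_Rintegral => x _; exact: dens2_sym.
- move=> a v w z hv hw hz; rewrite !energy2E -RintegralZl//; last exact: integrable_dens2.
  rewrite -RintegralD//; last 2 first.
  - by apply: integrableZR => //; exact: integrable_dens2.
  - exact: integrable_dens2.
  by apply: eq_Rintegral => x _; exact: dens2_lin.
move=> v hv; rewrite energy2E.
pose I w := \int[leb]_(x in Omega) dens A kappa w x.
have di w : H1 w -> leb.-integrable Omega (EFin \o dens A kappa w).
  by move=> hw; apply: integrable_dens => //; exact: H1L4.
have Imin w : H1 w -> I u <= I w.
  move=> hw; have := umin.2 _ hw; rewrite !energyE.
  have fin z : H1 z -> (\int[leb]_(x in Omega) (dens A kappa z x)%:E)%E = (I z)%:E.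
    by move=> hz; rewrite /I /Rintegral fineK//; exact: integrable_fin_num (di _ hz).
  by rewrite !fin// -!EFinM lee_fin ler_pM2l.
have d2 := integrable_dens2 hv hv.
have qq : leb.-integrable Omega (EFin \o (fun x => dotv v v x * dotv v v x)).
  by apply: sqintM => //; exact: H1L4.
set b := \int[leb]_(x in Omega) dens2 A kappa u v v x.
pose q := \int[leb]_(x in Omega) (dotv v v x * dotv v v x).
have key t : 0 <= 2 * t ^+ 2 * b + kappa ^+ 2 * t ^+ 4 * q.
  have hp s : H1 (u + s *: v) by rewrite addrC; exact: hH1.2.
  have IE : I (u + t *: v) + I (u + - t *: v) =
      2 * I u + (2 * t ^+ 2 * b + kappa ^+ 2 * t ^+ 4 * q).
    rewrite /b /q -[2 * I u]RintegralZl//; last exact: di.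
    rewrite -[X in _ = _ + (X + _)]RintegralZl// -[X in _ = _ + (_ + X)]RintegralZl//.
    rewrite -[X in _ = _ + X]RintegralD//; [|exact: integrableZR|exact: integrableZR].
    rewrite -[RHS]RintegralD//; last 2 first.
    - by apply: integrableZR => //; exact: di.
    - by apply: integrableDR => //; exact: integrableZR.
    rewrite -[LHS]RintegralD//; [|exact: di|exact: di].
    by apply: eq_Rintegral => x _; exact: dens_second_difference.
  have := lerD (Imin _ (hp t)) (Imin _ (hp (- t))).
  by rewrite IE [2 * I u]mulr_natl mulr2n lerDl.
rewrite leNgt; apply/negP => b0.
have q0 : 0 <= q by apply: Rintegral_ge0 => x _; rewrite -expr2 sqr_ge0.
have k2 : 0 < kappa ^+ 2 by rewrite exprn_gt0.
(* Taking [t ^+ 2 = s] makes the quartic term too small to compensate a negative [b]: the factor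
   [2 * b + s * (kappa ^+ 2 * q)] is at most [b]. *)
pose s := - b / (kappa ^+ 2 * q + 1).
have kq : 0 <= kappa ^+ 2 * q by rewrite mulr_ge0 ?(ltW k2).
have s0 : 0 < s by rewrite divr_gt0 ?oppr_gt0// ltr_wpDl.
have := key (Num.sqrt s); rewrite (exprM _ 2 2) sqr_sqrtr ?(ltW s0)//.
have -> : 2 * s * b + kappa ^+ 2 * s ^+ 2 * q = s * (2 * b + s * (kappa ^+ 2 * q)) by ring.
rewrite pmulr_rge0//.
have : s * (kappa ^+ 2 * q) <= - b.
  by rewrite /s mulrAC ler_pdivrMr ?ltr_wpDl// ler_wpM2l ?lerDl// oppr_ge0 ltW.
by move=> h1 h2; lra.
Qed.

(** The inf-sup quotients range over nonnull jets only; this settles the remaining ones. *)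
Lemma energy2_null v w : H1 v -> H1 w -> H1_eq Omega v 0 -> B u v w = 0.
Proof.
move=> hv hw /H1_eqP v0; rewrite energy2E /Rintegral.
rewrite (ae_eq_integral (cst 0%E)) ?integral0//.
- by have /integrableP[] := integrable_dens2 hv hw.
- apply: filterS v0 => x h Ox; have c0 j : cpt v j x = 0 by rewrite h// cpt0.
  rewrite /= /dens2 /dotv !c0 big1; last first.
    by move=> [b i] _; rewrite /mcp /= !c0; case: b; ring.
  by congr EFin; ring.
Qed.

End form.
End second_variation.

(** * Coercivity on the complement of the gauge direction *)

Lemma semi_innerW (R : realType) (V : lmodType R) (S S' : set V) (Q : V -> V -> R) :
  S `<=` S' -> semi_inner S' Q -> semi_inner S Q.
Proof.
move=> SS' [[sQ lQ] Q0]; split; first split.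
- by move=> x y /SS' ? /SS' ?; exact: sQ.
- by move=> a x y z /SS' ? /SS' ? /SS' ?; exact: lQ.
- by move=> x /SS' ?; exact: Q0.
Qed.

Section coercivity.
Context {R : realType} {d : nat}.
Local Notation jet := (@jet R d).
Local Notation leb := (@lebesgue_rV R d).
Variables (Omega : set 'rV[R]_d) (A : 'rV[R]_d -> 'rV[R]_d) (kappa : R).
Hypotheses (oOmega : open Omega) (bOmega : bounded_set Omega).
Hypotheses (hA : Linfty_field Omega A) (kappa0 : 0 < kappa).
Local Notation H1 := (H1 Omega).
Local Notation sq := (sqint leb Omega).
Local Notation dot := (dotI leb Omega).
Local Notation P := (H1form Omega kappa).
Local Notation N := (fnorm P).
Local Notation L4 := (L4 Omega).
Local Notation B := (energy2 Omega A kappa).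
Implicit Types (u v w z : jet) (x : 'rV[R]_d).

Let mOmega : measurable Omega. Proof. exact: open_measurable_rV. Qed.
Let hH1 : lin_closed H1. Proof. exact: H1_lin_closed. Qed.
Let hP : semi_inner H1 P. Proof. exact: H1form_semi_inner. Qed.

Definition iuform u w := dot (cpt u (false, None)) (cpt w (true, None)) -
  dot (cpt u (true, None)) (cpt w (false, None)).

Lemma mform_iu u w : H1 u -> H1 w ->
  mform Omega (fun x => 'i%C * u.1 x) w.1 = iuform u w.
Proof.
move=> hu hw; rewrite /iuform /dotI -RintegralB//; [|by apply: sqintM => //; exact: sq_cpt..].
apply: eq_Rintegral => x _; rewrite /cpt /=.
by case: (u.1 x) (w.1 x) => [a b] [p q] /=; ring.
Qed.

Lemma iuform_lin u a w z : H1 u -> H1 w -> H1 z ->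
  iuform u (a *: w + z) = a * iuform u w + iuform u z.
Proof.
move=> hu hw hz; have [[dC dL] _] := dotI_semi_inner leb mOmega.
have dR j k : dot (cpt u k) (cpt (a *: w + z) j) =
    a * dot (cpt u k) (cpt w j) + dot (cpt u k) (cpt z j).
  have su := sq_cpt oOmega k hu; have sw := sq_cpt oOmega j hw; have sz := sq_cpt oOmega j hz.
  have cE : cpt (a *: w + z) j = a *: (cpt w j : _ -> R^o) + cpt z j.
    by apply/funext => x; rewrite cptD cptZ.
  have swz : sq (cpt (a *: w + z) j) by apply: (sq_cpt oOmega); exact: hH1.2.
  by rewrite (dC _ _ su swz) cE (dL _ _ _ _ sw sz su) (dC _ _ su sw) (dC _ _ su sz).
by rewrite /iuform !dR; ring.
Qed.

Lemma iuform0 u : H1 u -> iuform u 0 = 0.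
Proof.
move=> hu; have := iuform_lin 1 hu hH1.1 hH1.1; rewrite scaler0 addr0 mul1r => /eqP.
by rewrite -subr_eq subrr eq_sym => /eqP.
Qed.

Lemma iuform_bounded u : H1 u -> exists K, forall w, H1 w -> `|iuform u w| <= K * N w.
Proof.
move=> hu; have hd := dotI_semi_inner leb mOmega; have hL := sqint_lin_closed leb mOmega.
have key j k : exists K, forall w, H1 w -> `|dot (cpt u j) (cpt w k)| <= K * N w.
  exists (fnorm dot (cpt u j) * Num.sqrt (wt kappa k)^-1) => w hw.
  apply: (le_trans (form_le_fnorm hL hd (sq_cpt oOmega j hu) (sq_cpt oOmega k hw))).
  rewrite -mulrA ler_wpM2l ?fnorm_ge0// /fnorm -sqrtrM ?invr_ge0 ?(ltW (wt_gt0 _ _))//.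
  by rewrite ler_wsqrtr// dot_cpt_le.
have [K1 h1] := key (false, None) (true, None).
have [K2 h2] := key (true, None) (false, None).
exists (K1 + K2) => w hw; rewrite mulrDl.
by apply: (le_trans (ler_normB _ _)); rewrite lerD ?h1 ?h2.
Qed.

Lemma H1iuP u w : H1 u -> H1iu Omega u w <-> H1 w /\ iuform u w = 0.
Proof.
by move=> hu; split=> -[hw h]; split => //; move: h; rewrite mform_iu.
Qed.

Lemma H1iu_lin_closed u : H1 u -> lin_closed (H1iu Omega u).
Proof.
move=> hu; split=> [|a w z /(H1iuP _ hu)[hw w0] /(H1iuP _ hu)[hz z0]]; apply/H1iuP => //.
  split; first exact: hH1.1.
  exact: iuform0.
by split; [exact: hH1.2|rewrite iuform_lin// w0 z0 mulr0 addr0].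
Qed.

(** The complement is the kernel of the continuous functional [iuform u], so the limit taken in
    $H^1$ stays in it. *)
Lemma H1iu_geom_complete u : H1 u -> geom_complete (H1iu Omega u) P.
Proof.
move=> hu x hx dx.
have hxH n : H1 (x n) by have [] := hx n.
have [y hy ylim] := H1_geom_complete oOmega bOmega kappa0 hxH dx.
exists y => //; apply/H1iuP => //; split => //.
have [K hK] := iuform_bounded hu.
apply/eqP; rewrite -normr_le0; apply/ler_addgt0Pr => e e0; rewrite add0r.
have K1 : 0 < `|K| + 1 by rewrite ltr_wpDl.
have [m /(_ m (leqnn m)) hm] := ylim _ (divr_gt0 e0 K1).
have /H1iuP -/(_ hu)[_ xm0] := hx m.
have -> : iuform u y = iuform u (y - x m).
  by rewrite addrC -scaleN1r iuform_lin// xm0 mulr0 add0r.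
apply: (le_trans (hK _ (lin_closedB hH1 hy (hxH m)))).
apply: (@le_trans _ _ ((`|K| + 1) * N (y - x m))).
  by rewrite ler_wpM2r ?fnorm_ge0// (le_trans (ler_norm K))// lerDl.
by rewrite -ler_pdivlMl// mulrC.
Qed.

(** * From the inf-sup constant to discrete stability and solvability *)

Section inf_sup.
Variable u : jet.
Hypotheses (umin : minimizer Omega A kappa u) (uniq : locally_unique Omega A kappa u).
Variable alpha : R.
Hypotheses (alpha0 : 0 < alpha) (halpha : alpha <= inf_sup Omega A kappa u).
Local Notation S := (H1iu Omega u).

Let hu : H1 u. Proof. exact: umin.1. Qed.
Let H1L4 v : H1 v -> L4 v. Proof. exact: (locally_unique_L4 oOmega bOmega hA kappa0 umin uniq). Qed.
Let SH1 : S `<=` H1. Proof. by move=> w []. Qed.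
Let hS : lin_closed S. Proof. exact: H1iu_lin_closed. Qed.
Let hPS : semi_inner S P. Proof. exact: semi_innerW SH1 hP. Qed.
Let hB : semi_inner H1 (B u).
Proof. exact: (energy2_semi_inner oOmega bOmega hA kappa0 H1L4 umin). Qed.
Let hBS : semi_inner S (B u). Proof. exact: semi_innerW SH1 hB. Qed.

Lemma fnorm_gt0P w : H1 w -> 0 < N w <-> ~ H1_eq Omega w 0.
Proof.
move=> hw; rewrite sqrtr_gt0 lt_neqAle (hP.2 _ hw) andbT eq_sym; split.
  by move=> /eqP w0 /(H1form_eq0 oOmega kappa0 hw).
by move=> w0; apply/eqP => /(H1form_eq0 oOmega kappa0 hw).
Qed.

(** The witness [e] is the inner supremum at [v]. Were it or the outer infimum undefined, its value
    would be 0, against [0 < alpha]. *)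
Lemma inf_sup_attained v : S v -> 0 < N v -> exists e : R,
  [/\ forall w, S w -> B u v w <= e * N v * N w &
      forall K, (forall w, S w -> B u v w <= K * N v * N w) -> alpha <= K].
Proof.
move=> Sv Nv.
pose F v := [set B u v w / (H1k_norm Omega kappa v * H1k_norm Omega kappa w) | w in
  [set w | S w /\ ~ H1_eq Omega w 0]].
pose E := [set sup (F v) | v in [set v | S v /\ ~ H1_eq Omega v 0]].
have aE : alpha <= inf E := halpha.
have hE : has_inf E.
  by apply: contrapT => /inf_out E0; move: aE; rewrite E0 leNgt alpha0.
have Ev : alpha <= sup (F v).
  apply: (le_trans aE); apply: (ge_inf hE.2); exists v => //; split => //.
  by apply/fnorm_gt0P => //; exact: SH1.
have hF : has_sup (F v).
  by apply: contrapT => /sup_out F0; move: Ev; rewrite F0 leNgt alpha0.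
have FE w : S w -> 0 < N w -> F v (B u v w / (N v * N w)).
  move=> Sw Nw; exists w; first by split => //; apply/fnorm_gt0P => //; exact: SH1.
  by rewrite !(H1k_normE oOmega)//; exact: SH1.
exists (sup (F v)); split=> [w Sw|K hK].
  have [Nw|Nw] := ltP 0 (N w).
    by rewrite -mulrA -ler_pdivrMr ?mulr_gt0//; apply: (ub_le_sup hF.2); exact: FE.
  have Nw0 : N w = 0 by apply/eqP; rewrite eq_le Nw fnorm_ge0.
  rewrite Nw0 mulr0 hBS.1.1// (energy2_null oOmega bOmega hA H1L4 umin)//;
    [exact: SH1|exact: SH1|].
  by apply: contrapT => /(fnorm_gt0P (SH1 Sw)); rewrite Nw0 ltxx.
apply: (le_trans Ev); apply: ge_sup => [|_ [w [Sw w0] <-]]; first exact: hF.1.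
have {}w0 : 0 < N w by apply/fnorm_gt0P => //; exact: SH1.
rewrite !(H1k_normE oOmega); [|exact: SH1..].
by rewrite ler_pdivrMr ?mulr_gt0// mulrA hK.
Qed.

Lemma energy2_sep_bounded v : S v -> exists K, forall w, S w -> B u v w <= K * N w.
Proof.
move=> Sv; have [Nv|Nv] := ltP 0 (N v).
  by have [e [he _]] := inf_sup_attained Sv Nv; exists (e * N v).
exists 0 => w Sw; rewrite mul0r (energy2_null oOmega bOmega hA H1L4 umin)//;
    [exact: SH1|exact: SH1|].
by apply: contrapT => /(fnorm_gt0P (SH1 Sv)); rewrite ltNge Nv.
Qed.

Lemma energy2_coercive v : S v -> alpha * P v v <= B u v v.
Proof.
move: v; have [M M0 hM] := separately_bounded_form hS hPS hBS energy2_sep_bounded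
  (H1iu_geom_complete hu).
apply: (inf_sup_coercive hS hPS hBS M0 hM) => v K Sv Nv hK.
by have [e [_ ->]] := inf_sup_attained Sv Nv.
Qed.

Lemma dual_norm_ub (T : set jet) (F : jet -> R) K w : T `<=` S ->
  (forall phi, T phi -> F phi <= K * N phi) -> T w -> 0 < N w ->
  F w / N w <= dual_norm Omega kappa T F.
Proof.
move=> TS FK Tw Nw; have TH := subset_trans TS SH1.
apply: ub_le_sup; last first.
  exists w; last by rewrite (H1k_normE oOmega)//; exact: TH.
  by split => //; apply/fnorm_gt0P => //; exact: TH.
exists K => _ [phi [Tphi /(fnorm_gt0P (TH _ Tphi)) phi0] <-].
by rewrite (H1k_normE oOmega)// ?ler_pdivrMr ?FK//; exact: TH.
Qed.

(** The supremum has no absolute values, so a test vector with [F psi >= 0] must be provided. If all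
    of [T] is null, the supremum is over the empty set and equals 0. *)
Lemma dual_norm_ge0 (T : set jet) (F : jet -> R) K : T `<=` S ->
  (forall phi, T phi -> F phi <= K * N phi) ->
  (forall phi, T phi -> exists2 psi, T psi & 0 <= F psi /\ N psi = N phi) ->
  0 <= dual_norm Omega kappa T F.
Proof.
move=> TS FK Fpos; have TH := subset_trans TS SH1.
have [[phi [Tphi /(fnorm_gt0P (TH _ Tphi)) Nphi]]|T0] :=
  pselect (exists phi, T phi /\ ~ H1_eq Omega phi 0).
  have [psi Tpsi [F0 Npsi]] := Fpos _ Tphi.
  rewrite (le_trans _ (dual_norm_ub TS FK Tpsi _)) ?Npsi// divr_ge0// ltW//.
rewrite /dual_norm [X in sup X](_ : _ = set0) ?sup0//.
by apply/seteqP; split => // r [phi phi1 _]; apply: T0; exists phi.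
Qed.

(** Coercivity allows testing with [w] itself, which belongs to [T]. *)
Lemma discrete_stability (T : set jet) w : T `<=` S -> T w ->
  N w <= alpha^-1 * dual_norm Omega kappa T (B u w).
Proof.
move=> TS Tw; have Sw := TS _ Tw.
have [K hK] := energy2_sep_bounded Sw.
have hKT phi : T phi -> B u w phi <= K * N phi by move=> /TS; exact: hK.
have [Nw|Nw] := ltP 0 (N w).
  rewrite ler_pdivlMl// (le_trans _ (dual_norm_ub TS hKT Tw Nw))//.
  by rewrite ler_pdivlMr// -mulrA -expr2 (sqr_fnorm hPS)// energy2_coercive.
rewrite (le_trans Nw)// mulr_ge0 ?invr_ge0 ?(ltW alpha0)//.
apply: (dual_norm_ge0 TS hKT) => phi Tphi; exists phi => //; split => //.
rewrite (energy2_null oOmega bOmega hA H1L4 umin)//; [exact: SH1|exact/SH1/TS|].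
by apply: contrapT => /(fnorm_gt0P (SH1 Sw)); rewrite ltNge Nw.
Qed.

Lemma discrete_solution (Vh : set jet) f : fin_dim_subspace Omega Vh ->
  dual_functional Omega kappa S f ->
  exists w, [/\ (Vh `&` S) w,
    forall phi, (Vh `&` S) phi -> B u w phi = f phi,
    forall w', (Vh `&` S) w' -> (forall phi, (Vh `&` S) phi -> B u w' phi = f phi) ->
      H1_eq Omega w' w
    & N w <= alpha^-1 * dual_norm Omega kappa S f].
Proof.
move=> [n [b [hb ->]]] [flin [K hK]].
have fK phi : S phi -> `|f phi| <= K * N phi.
  by move=> Sphi; have := hK _ Sphi; rewrite (H1k_normE oOmega)//; exact: SH1.
have f_lin a (x y : jet) : S x -> S y -> f (a *: x + y) = a * f x + f y.
  move=> Sx Sy; have := flin a 1 x y Sx Sy; rewrite mul1r => <-; congr f.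
  by rewrite -[y in LHS]scale1r.
have f_null (x : jet) : S x -> P x x = 0 -> f x = 0.
  move=> Sx Px; apply/eqP; rewrite -normr_le0 (le_trans (fK _ Sx))//.
  by rewrite /fnorm Px sqrtr0 mulr0.
have P_null (x : jet) : S x -> B u x x = 0 -> P x x = 0.
  move=> Sx Bx; have := energy2_coercive Sx; rewrite Bx pmulr_rle0// => h.
  by apply/eqP; rewrite eq_le h hPS.2.
(* Orthogonality to [iu] is one linear equation on the coefficients, and the rows of [kermx col]
   span its solutions. The vectors [e j] below thus generate the constrained space up to null
   jets. *)
pose col := \col_i iuform u (b i).
pose comb (c : 'I_n -> R) : jet := \sum_i c i *: b i.
have Hcomb c : H1 (comb c) by apply: lin_closed_sum => // i; exact: lin_closedZ.
have f00 : f 0 = 0 by apply: f_null; [exact: hS.1|rewrite (form0l hS hPS.1)//; exact: hS.1].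
have iu_comb c : iuform u (comb c) = \sum_i c i * iuform u (b i).
  suff [] : H1 (comb c) /\ iuform u (comb c) = \sum_i c i * iuform u (b i) by [].
  rewrite /comb; elim: (index_enum _) => [|i r [Hr ih]].
    by rewrite !big_nil; split; [exact: hH1.1|exact: iuform0].
  by rewrite !big_cons iuform_lin// ih; split=> //; exact: hH1.2.
pose e j : jet := comb (kermx col j).
have Se j : S (e j).
  apply/H1iuP => //; split; first exact: Hcomb.
  rewrite iu_comb; have /matrixP/(_ j ord0) := mulmx_ker col.
  rewrite mxE [RHS]mxE => h; rewrite -[RHS]h.
  by apply: eq_bigr => i _; congr (_ * _); rewrite mxE.
have comb_e (D : 'I_n -> R) : \sum_j D j *: e j = comb (fun i => \sum_j D j * kermx col j i).
  rewrite /e /comb; under eq_bigr do rewrite scaler_sumr.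
  rewrite exchange_big /=; apply: eq_bigr => i _; rewrite scaler_suml.
  by apply: eq_bigr => j _; rewrite scalerA.
have [|c hc] := galerkin_solution hS hBS f_lin _ Se.
  by move=> x Sx /(P_null _ Sx); exact: f_null.
set w := \sum_j _ in hc.
have Sw : S w by apply: lin_closed_sum => // j; exact: lin_closedZ.
have Vw : [set w | H1 w /\ exists c, H1_eq Omega w (jcomb c b)] w.
  split; first exact: SH1.
  by eexists; rewrite /w comb_e; apply: aeW => x _; split.
(* A member of the discrete space is only almost everywhere a combination of the [b i]. The
   difference has norm zero, so [iuform u], [f] and [B u w] do not see it. *)
have solw phi : S phi -> (exists c, H1_eq Omega phi (jcomb c b)) -> B u w phi = f phi.
  move=> Sphi [c' phic]; have hphi := SH1 Sphi.
  have Hd : H1 (phi - comb c') by exact: lin_closedB.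
  have Pd : P (phi - comb c') (phi - comb c') = 0.
    apply/(H1form_eq0 oOmega kappa0 Hd)/H1_eqP; move/H1_eqP : phic.
    by apply: filterS => x h Ox j; rewrite cptB h// cpt0 subrr.
  have iuc : iuform u (comb c') = 0.
    have [K' hK'] := iuform_bounded hu.
    have := hK' _ Hd; rewrite /fnorm Pd sqrtr0 mulr0 normr_le0 => /eqP.
    rewrite addrC -scaleN1r iuform_lin//; have /H1iuP -/(_ hu)[_ ->] := Sphi.
    by rewrite addr0 mulN1r => /eqP; rewrite oppr_eq0 => /eqP.
  have Sc : S (comb c') by apply/H1iuP.
  have Sd : S (phi - comb c') by exact: lin_closedB.
  have fphi : f phi = f (comb c').
    have := f_lin (-1) _ _ Sc Sphi; rewrite scaleN1r addrC (f_null _ Sd Pd) => h.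
    by apply/eqP; rewrite -subr_eq0 h mulN1r addrC.
  have Bphi : B u w phi = B u w (comb c').
    have := formBr hS hBS.1 Sphi Sc Sw; rewrite hBS.1.1// => h.
    apply/eqP; rewrite -subr_eq0 -h (energy2_null oOmega bOmega hA H1L4 umin)//.
      exact: SH1.
    by apply/(H1form_eq0 oOmega kappa0 Hd).
  rewrite fphi Bphi.
  pose cr := \row_i c' i.
  have /submxP[D hD] : (cr <= kermx col)%MS.
    apply/sub_kermxP/matrixP => i j; rewrite mxE [RHS]mxE -[RHS]iuc iu_comb.
    by apply: eq_bigr => k _; rewrite !mxE.
  have -> : comb c' = \sum_j D ord0 j *: e j.
    rewrite comb_e; apply: eq_bigr => i _; congr (_ *: _).
    by have /matrixP/(_ ord0 i) := hD; rewrite mxE => ->; rewrite mxE.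
  have SD : S (\sum_j D ord0 j *: e j) by apply: lin_closed_sum => // j; exact: lin_closedZ.
  rewrite hBS.1.1// (form_suml hS hBS.1)//; last by move=> j; exact: lin_closedZ.
  have [_ ->] : S (\sum_j D ord0 j *: e j) /\
      f (\sum_j D ord0 j *: e j) = \sum_j D ord0 j * f (e j).
    elim: (index_enum _) => [|i r [Sr ih]]; first by rewrite !big_nil; split; first exact: hS.1.
    by rewrite !big_cons f_lin// ih; split=> //; exact: hS.2.
  by apply: eq_bigr => j _; rewrite (formZl hS hBS.1)// hBS.1.1// hc.
exists w; split => //.
- by move=> phi [[_ Vphi] Sphi]; exact: solw.
- move=> w' [Vw' Sw'] sol'.
  have Sd : S (w' - w) by exact: lin_closedB.
  (* Both solutions lie in the test space, so their difference may be tested with itself; coercivity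
     then makes it null. *)
  have : B u (w' - w) (w' - w) = 0.
    have orth phi : ([set w | H1 w /\ exists c, H1_eq Omega w (jcomb c b)] `&` S) phi ->
        B u (w' - w) phi = 0.
      move=> Vphi; have [[_ hphi] Sphi] := Vphi.
      by rewrite (formBl hBS.1)// sol'// solw// subrr.
    by rewrite (formBr hS hBS.1)// !orth// subrr.
  move=> /(P_null _ Sd)/(H1form_eq0 oOmega kappa0 (SH1 Sd))/H1_eqP h.
  apply/H1_eqP; apply: filterS h => x h Ox j; apply/eqP.
  by rewrite -subr_eq0 -cptB h// cpt0.
have fK' phi : S phi -> f phi <= K * N phi.
  by move=> /fK; apply: le_trans; exact: ler_norm.
have [Nw|Nw] := ltP 0 (N w).
  rewrite ler_pdivlMl// (le_trans _ (dual_norm_ub _ fK' Sw Nw))//.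
  rewrite ler_pdivlMr// -mulrA -expr2 (sqr_fnorm hPS)//.
  by rewrite (le_trans (energy2_coercive Sw))// solw//; case: Vw.
rewrite (le_trans Nw)// mulr_ge0 ?invr_ge0 ?(ltW alpha0)//.
apply: (dual_norm_ge0 _ fK') => // phi Sphi.
have Sn := lin_closedZ hS (-1) Sphi.
(* One of [phi] and its opposite has a nonnegative value under [f], and both have the same norm. *)
have [f0|f0] := leP 0 (f phi); first by exists phi.
exists (-1 *: phi) => //; split; last by rewrite (fnormZ hS hPS)// normrN1 mul1r.
have ff := f_lin (-1) _ _ Sphi hS.1; rewrite addr0 mulN1r in ff.
by rewrite ff f00 addr0 oppr_ge0 ltW.
Qed.

End inf_sup.
End coercivity.

Theorem lemma5p4 (R : realType) (d : nat) (hd : d = 2%N \/ d = 3%N)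
    (Omega : set 'rV[R]_d) (hOmega : polytopal_lipschitz_domain Omega)
    (A : 'rV[R]_d -> 'rV[R]_d) (hA : Linfty_field Omega A)
    (hdiv : divergence_free Omega A) (hnu : zero_normal_trace Omega A)
    (Capp : R) (hCapp : 0 < Capp) (c0 : R) (hc0 : 0 < c0) :
  exists c C : R, [/\ 0 < c, 0 < C &
    forall (kappa : R) (hkappa : 0 < kappa)
      (huniq : forall u, minimizer Omega A kappa u ->
                         locally_unique Omega A kappa u)
      (V : R -> set (jet (R := R) (d := d)))
      (hV : forall h, 0 < h -> fin_dim_subspace Omega (V h))
      (hP1 : property_P1 Omega V)
      (hP2 : property_P2 Omega A kappa V Capp)
      (u : jet) (hu : minimizer Omega A kappa u)
      (Csol : R) (hCsol0 : c0 <= Csol)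
      (hCsol : Csol^-1 <= inf_sup Omega A kappa u)
      (h : R) (hh : 0 < h),
    let Vperp := V h `&` H1iu Omega u in
    (kappa * Csol * h <= c ->
       forall w, Vperp w ->
         H1k_norm Omega kappa w <=
         C * Csol * dual_norm Omega kappa Vperp (energy2 Omega A kappa u w))
    /\
    (forall f, dual_functional Omega kappa (H1iu Omega u) f ->
       exists w, [/\ Vperp w,
         (forall phi, Vperp phi -> energy2 Omega A kappa u w phi = f phi),
         (forall w', Vperp w' ->
            (forall phi, Vperp phi -> energy2 Omega A kappa u w' phi = f phi) ->
            H1_eq Omega w' w)
         & H1k_norm Omega kappa w <=
           C * Csol * dual_norm Omega kappa (H1iu Omega u) f])].
Proof.
have [_ oOmega _ bOmega _] := hOmega.
exists 1, 1; split=> // kappa hkappa huniq V hV _ _ u hu Csol hCsol0 hCsol h hh Vperp.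
have Csol0 : 0 < Csol by exact: lt_le_trans hCsol0.
have alpha0 : 0 < Csol^-1 by rewrite invr_gt0.
have uniq := huniq u hu.
split=> [_ w Vw|f hf].
  have [Hw _] := Vw.2.
  rewrite (H1k_normE oOmega)// mul1r -[Csol in leRHS]invrK.
  apply: (discrete_stability oOmega bOmega hA hkappa hu uniq alpha0 hCsol) => //.
  exact: subIsetr.
have [w [Vw sol uniqw Nw]] := discrete_solution oOmega bOmega hA hkappa hu uniq alpha0 hCsol
  (hV h hh) hf.
exists w; split => //.
have [Hw _] := Vw.2.
by rewrite (H1k_normE oOmega)// mul1r -[Csol in leRHS]invrK.
Qed.
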